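(* Let $\mathcal{D}=[0,D]^d$ with $D>0$, $d\in\mathbb{N}$, let $l$ be a Lévy process with Lévy triplet $(\gamma,b,\nu)$, let $W$ be a Gaussian random field on $\mathcal{D}$ independent of $l$ with mean function $\mu_W$, let $F:\mathbb{R}\to\mathbb{R}_+$ be measurable, and consider the Gaussian subordinated Lévy field $l(F(W(\underline{x})))$, $\underline{x}\in\mathcal{D}$. Let $l^{(\varepsilon_l)}\approx l$ be a càdlàg approximation of the Lévy process and $W^N\approx W$ an approximation of the Gaussian random field, where the mean function $\mu_W$ is assumed to be known and does not need to be approximated. (1) For every $\underline{x}\in\mathcal{D}$, the pointwise characteristic function of the approximated field is $$\phi_{l^{(\varepsilon_l)}(F(W^N(\underline{x})))}(\xi)=\mathbb{E}\Big(\exp\big(i\xi\,l^{(\varepsilon_l)}(F(W^N(\underline{x})))\big)\Big)=\mathbb{E}\big(\rho_{l^{(\varepsilon_l)}}(F(W^N(\underline{x})),\xi)\big),\quad \xi\in\mathbb{R},$$ where $\rho_{l^{(\varepsilon_l)}}(t,\xi)=\mathbb{E}(\exp(i\xi\,l^{(\varepsilon_l)}(t)))$ denotes the pointwise characteristic function of $l^{(\varepsilon_l)}$. (2) Suppose in addition that $F(\cdot)<C_F$ with a constant $C_F>0$, that $\{t_i,\ i=0,\dots,N_l\}$ is a grid with $t_0=0$, $t_{N_l}=C_F$ and $t_{i+1}-t_i=\varepsilon_l>0$ for $i=0,\dots,N_l-1$, that $$l^{(\varepsilon_l)}(t)=\sum_{i=1}^{N_l}\mathbf{1}_{[t_{i-1},t_i)}(t)\,l(t_{i-1}),\qquad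 t\in[0,C_F),$$ and that $W$ is approximated with the truncated Karhunen-Loève expansion $$W^N(\underline{x})=\mu_W(\underline{x})+\sum_{i=1}^N\sqrt{\lambda_i}Z_ie_i(\underline{x})\approx\mu_W(\underline{x})+\sum_{i=1}^\infty\sqrt{\lambda_i}Z_ie_i(\underline{x})=W(\underline{x}),\qquad \underline{x}\in\mathcal{D},$$ with some $N\in\mathbb{N}$, i.i.d. standard normal random variables $(Z_i)_{i\in\mathbb{N}}$ and eigenpairs $((\lambda_i,e_i))_{i\in\mathbb{N}}$ of the covariance operator of $W$. Then for every $\underline{x}\in\mathcal{D}$ and every $\xi\in\mathbb{R}$, $$\phi_{l^{(\varepsilon_l)}(F(W^N(\underline{x})))}(\xi)=\frac{1}{\sqrt{2\pi\sigma_{W,N}^2(\underline{x})}}\int_{\mathbb{R}}\exp\Big(t_{\lfloor F(y)/\varepsilon_l\rfloor}\,\psi(\xi)-\frac{(y-\mu_W(\underline{x}))^2}{2\sigma_{W,N}^2(\underline{x})}\Big)\,dy.$$ Here $\sigma_{W,N}^2$ is the variance function of $W^N$, given by $$\sigma_{W,N}^2(\underline{x}):=\mathrm{Var}(W^N(\underline{x}))=\mathbb{E}\Big(\Big(\sum_{i=1}^N\sqrt{\lambda_i}Z_ie_i(\underline{x})\Big)^2\Big)=\sum_{i=1}^N\lambda_ie_i^2(\underline{x}),\quad \underline{x}\in\mathcal{D},$$ $\psi$ denotes the characteristic exponent of $l$, $$\psi(\xi)=i\gamma\xi-\frac b2\xi^2+\int_{\mathbb{R}\setminus\{0\}}\Big(e^{i\xi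 y}-1-i\xi y\,\mathbf{1}_{\{|y|\le1\}}(y)\Big)\,\nu(dy),$$ and $\lfloor x\rfloor$ denotes the largest integer smaller than or equal to $x$.
   Context: All random objects live on a complete probability space $(\Omega,\mathcal{F},\mathbb{P})$; $\mathbb{R}_+=[0,\infty)$. A Lévy process $l$ is a real-valued stochastic process with $l(0)=0$ a.s., independent and stationary increments, stochastically continuous, and taken to have càdlàg paths. It has Lévy triplet $(\gamma,b,\nu)$ ($\gamma\in\mathbb{R}$, $b\ge0$, $\nu$ a measure on $\mathbb{R}$ with $\int_{\mathbb{R}}\min(y^2,1)\,\nu(dy)<\infty$) if $\mathbb{E}(\exp(i\xi l(t)))=\exp(t\psi(\xi))$ with $\psi$ as in the claim. A Gaussian random field on $\mathcal{D}$ is a family of real random variables indexed by $\mathcal{D}$ with multivariate Gaussian finite-dimensional distributions; it is assumed mean-square continuous and jointly measurable on $\Omega\times\mathcal{D}$. Its covariance operator on $L^2(\mathcal{D})$ is $Q(\varphi)(\underline{x})=\int_{\mathcal{D}}q_W(\underline{x},\underline{y})\varphi(\underline{y})\,d\underline{y}$ with $q_W$ the covariance function of $W$; its eigenfunctions $(e_i)$ form an orthonormal basis of $L^2(\mathcal{D})$ and the eigenvalues $(\lambda_i)$ are decreasing. $\phi_X$ denotes the characteristic function of a random variable $X$. In part (1), ''càdlàg approximation of $l$'' means a real-valued process with càdlàg paths standing in for $l$, and ''approximation of $W$'' means a real-valued random field on $\mathcal{D}$ standing in for $W$; no quantitative closeness is prescribed.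
   Formalization: Part (1) additionally assumes that the approximations l^(ε_l) and W^N are independent of each other (it fails for dependent ones), and the integral formula in (2) is stated only at points where σ²_{W,N}(x) ≠ 0. *)

(* Defs.v *)
From HB Require Import structures.
From mathcomp Require Import all_boot all_order all_algebra.
From mathcomp Require Import complex.
From mathcomp Require Import all_classical all_reals all_analysis.

Set Implicit Arguments.
Unset Strict Implicit.
Unset Printing Implicit Defensive.

Import Order.TTheory GRing.Theory Num.Theory.
Import numFieldNormedType.Exports.

Local Open Scope classical_set_scope.
Local Open Scope ring_scope.
Local Open Scope complex_scope.

Section tuple_lebesgue_measure.
Context {R : realType}.

(* Lebesgue measure on R^n, points being n-tuples: R^0 is a point of mass 1, and
   R^(n+1) carries the image of the product measure on R x R^n. *)
Definition tuple_cons n (p : R * n.-tuple R) : n.+1.-tuple R :=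
  [tuple of p.1 :: p.2].

Definition tuple_uncons n (t : n.+1.-tuple R) : R * n.-tuple R :=
  (thead t, [tuple of behead t]).

Lemma measurable_tuple_cons n : measurable_fun setT (@tuple_cons n).
Proof. by apply: measurable_cons. Qed.

Lemma measurable_tuple_uncons n : measurable_fun setT (@tuple_uncons n).
Proof.
apply: measurable_fun_pair; last exact: measurable_behead.
exact: measurable_tnth.
Qed.

Lemma tuple_consK n : cancel (@tuple_cons n) (@tuple_uncons n).
Proof. by case=> x t; congr pair; apply: val_inj. Qed.

Lemma tuple_unconsK n : cancel (@tuple_uncons n) (@tuple_cons n).
Proof. by move=> t; rewrite [RHS]tuple_eta. Qed.

Section step.
Variables (n : nat) (m : {sigma_finite_measure set (n.-tuple R) -> \bar R}).

Definition lebesgue_cons : set (n.+1.-tuple R) -> \bar R :=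
  pushforward ((@lebesgue_measure R) \x m)%E (@tuple_cons n).

Let cons_measure := measure_function_pushforward__canonical__measure_function_Measure
  (product_measure1 (@lebesgue_measure R) m) (@measurable_tuple_cons n).

HB.instance Definition _ := Measure.copy lebesgue_cons cons_measure.

Let lebesgue_cons_sigma_finite : sigma_finite setT lebesgue_cons.
Proof.
have /sigma_finiteP[F [TF ndF Foo]] := sigma_finiteT (@lebesgue_measure R).
have /sigma_finiteP[G [TG ndG Goo]] := sigma_finiteT m.
exists (fun k => @tuple_uncons n @^-1` (F k `*` G k)).
  rewrite -preimage_bigcup (_ : \bigcup_k _ = setT) ?preimage_setT//.
  apply/seteqP; split=> // -[x y] _.
  have [i _ Fix] : (\bigcup_k F k) x by rewrite -TF.
  have [j _ Gjy] : (\bigcup_k G k) y by rewrite -TG.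
  exists (maxn i j) => //; split=> /=.
  - by move: x Fix; exact/subsetPset/ndF/leq_maxl.
  - by move: y Gjy; exact/subsetPset/ndG/leq_maxr.
move=> k; have [mFk Fk] := Foo k; have [mGk Gk] := Goo k; split.
  rewrite -[X in measurable X]setTI; apply: measurable_tuple_uncons => //.
  exact: measurableX.
rewrite /lebesgue_cons /pushforward (_ : _ @^-1` _ = F k `*` G k); last first.
  apply/funext => p; congr ((F k `*` G k) _); exact: tuple_consK.
by rewrite product_measure1E// lte_mul_pinfty// ge0_fin_numE.
Qed.

HB.instance Definition _ :=
  Measure_isSigmaFinite.Build _ _ _ lebesgue_cons lebesgue_cons_sigma_finite.

End step.

Fixpoint tuple_lebesgue n : {sigma_finite_measure set (n.-tuple R) -> \bar R} :=
  match n with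
  | 0 => \d_([tuple] : 0.-tuple R)
  | n'.+1 => lebesgue_cons (tuple_lebesgue n')
  end.

End tuple_lebesgue_measure.

Section complex_valued.
Context {R : realType}.

Definition cexp (z : R[i]) : R[i] :=
  (expR (complex.Re z))%:C * (cos (complex.Im z) +i* sin (complex.Im z)).

Definition Cintegral d (T : measurableType d) (mu : {measure set T -> \bar R})
    (D : set T) (f : T -> R[i]) : R[i] :=
  (\int[mu]_(x in D) complex.Re (f x)) +i* (\int[mu]_(x in D) complex.Im (f x)).

Definition Cexpectation d (T : measurableType d) (P : probability T R)
    (f : T -> R[i]) : R[i] := Cintegral P setT f.

Definition char_fun d (T : measurableType d) (P : probability T R)
    (X : T -> R) (xi : R) : R[i] :=
  Cexpectation P (fun w => cexp ('i%C * (xi * X w)%:C)).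

End complex_valued.

Section independence.
Context d (T : measurableType d) (R : realType) (P : probability T R).

Definition mutually_independent (I : eqType) (X : I -> T -> R) : Prop :=
  forall (s : seq I) (B : I -> set R), uniq s -> (forall i, measurable (B i)) ->
    P (\bigcap_(i in [set` s]) (X i @^-1` B i)) =
      (\prod_(i <- s) P (X i @^-1` B i))%E.

Definition sigma_generated (I : Type) (J : set I) (X : I -> T -> R) :
    set (set T) :=
  <<s \bigcup_(i in J) preimage_set_system setT (X i) measurable >>.

Definition independent_processes (I I' : Type) (J : set I) (X : I -> T -> R)
    (J' : set I') (Y : I' -> T -> R) : Prop :=
  forall A B, sigma_generated J X A -> sigma_generated J' Y B ->
    P (A `&` B) = (P A * P B)%E.

End independence.

Section levy.
Context d (T : measurableType d) (R : realType) (P : probability T R).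

Definition cadlag (f : R -> R) : Prop :=
  forall t, 0 <= t ->
    (f s @[s --> t^'+] --> f t) /\ (0 < t -> cvg (f s @[s --> t^'-])).

(* Processes on [0, oo[ are total functions of t; values at t < 0 are junk and
   never constrained. *)
Definition levy_process (l : R -> {RV P >-> R}) : Prop :=
  [/\ {ae P, forall w, l 0 w = 0},
      forall t : nat -> R, 0 <= t 0 -> (forall i, t i < t i.+1) ->
        mutually_independent P (fun i w => l (t i.+1) w - l (t i) w),
      forall s t h, 0 <= s -> 0 <= t -> 0 <= h ->
        forall B, measurable B ->
          P [set w | B (l (s + h) w - l s w)] =
          P [set w | B (l (t + h) w - l t w)],
      forall t e, 0 <= t -> 0 < e ->
        P [set w | e < `|l s w - l t w|]
          @[s --> within [set s | 0 <= s] (nbhs t)] --> 0%E &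
      forall w, cadlag (fun t => l t w)].

Definition levy_measure (nu : {measure set R -> \bar R}) : Prop :=
  (\int[nu]_y (Num.min (y ^+ 2) 1)%:E < +oo)%E.

Definition char_exponent (gamma b : R) (nu : {measure set R -> \bar R})
    (xi : R) : R[i] :=
  'i%C * (gamma * xi)%:C - (b / 2 * xi ^+ 2)%:C +
  Cintegral nu (setT `\ 0) (fun y =>
    cexp ('i%C * (xi * y)%:C) - 1
      - 'i%C * (xi * y * \1_[set z | `|z| <= 1] y)%:C).

Definition levy_triplet (l : R -> {RV P >-> R}) (gamma b : R)
    (nu : {measure set R -> \bar R}) : Prop :=
  [/\ 0 <= b, levy_measure nu &
      forall t xi, 0 <= t ->
        char_fun P (l t) xi = cexp (t%:C * char_exponent gamma b nu xi)].

End levy.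

Section gaussian_field.
Context d (T : measurableType d) (R : realType) (P : probability T R).

Definition cube n (a : R) : set (n.-tuple R) :=
  [set x | forall i, 0 <= tnth x i <= a].

(* [normal_prob m s] is N(m, s^2) for s != 0 only, hence the separate point
   mass for a degenerate Gaussian variable. *)
Definition gaussian_var (X : T -> R) : Prop :=
  exists m s : R, forall B : set R, measurable B ->
    P (X @^-1` B) = if s == 0 then \d_m B else normal_prob m s B.

(* A random vector is multivariate Gaussian when all linear combinations of its
   components are univariate Gaussian, possibly degenerate. *)
Definition gaussian_field n (D : set (n.-tuple R))
    (W : n.-tuple R -> {RV P >-> R}) : Prop :=
  [/\ forall (k : nat) (x : 'I_k -> n.-tuple R) (a : 'I_k -> R),
        (forall i, D (x i)) ->
        gaussian_var (fun w => \sum_(i < k) a i * W (x i) w),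
      forall x, D x -> forall eps : R, 0 < eps ->
        exists2 delta : R, 0 < delta &
          forall y, D y -> (forall i, `|tnth y i - tnth x i| < delta) ->
            ('E_P[fun w => ((W y w - W x w) ^+ 2)%R] < eps%:E)%E &
      measurable_fun (setT `*` D) (fun p : T * n.-tuple R => W p.2 p.1)].

Definition cov_fun n (W : n.-tuple R -> {RV P >-> R}) (x y : n.-tuple R) : R :=
  fine (covariance P (W x) (W y)).

Definition cov_operator n (D : set (n.-tuple R))
    (W : n.-tuple R -> {RV P >-> R}) (phi : n.-tuple R -> R)
    (x : n.-tuple R) : R :=
  \int[tuple_lebesgue n]_(y in D) (cov_fun W x y * phi y).

Definition square_integrable n (D : set (n.-tuple R)) (f : n.-tuple R -> R) :
    Prop :=
  measurable_fun D f /\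
  (\int[tuple_lebesgue n]_(x in D) ((f x) ^+ 2)%:E < +oo)%E.

Definition L2_inner n (D : set (n.-tuple R)) (f g : n.-tuple R -> R) : R :=
  \int[tuple_lebesgue n]_(x in D) (f x * g x).

Definition orthonormal_basis n (D : set (n.-tuple R))
    (e : nat -> n.-tuple R -> R) : Prop :=
  [/\ forall i, square_integrable D (e i),
      forall i j, L2_inner D (e i) (e j) = (i == j)%:R &
      forall f, square_integrable D f ->
        (\int[tuple_lebesgue n]_(x in D)
            (f x - \sum_(i < k) L2_inner D f (e i) * e i x) ^+ 2)
          @[k --> \oo] --> (0 : R)].

(* Eigenpairs are numbered from 0. The eigenvalue equation is an identity in
   L^2(D), i.e. almost everywhere. Eigenvalues are nonnegative because covariance
   operators are; [Num.sqrt] would silently send a negative number to 0. *)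
Definition cov_eigenpairs n (D : set (n.-tuple R))
    (W : n.-tuple R -> {RV P >-> R}) (lam : nat -> R)
    (e : nat -> n.-tuple R -> R) : Prop :=
  [/\ orthonormal_basis D e,
      forall i, 0 <= lam i,
      forall i, lam i.+1 <= lam i &
      forall i, {ae tuple_lebesgue n, forall x, D x ->
        cov_operator D W (e i) x = lam i * e i x}].

Definition iid_standard_normal (Z : nat -> {RV P >-> R}) : Prop :=
  mutually_independent P (fun i => Z i : T -> R) /\
  forall i (B : set R), measurable B ->
    distribution P (Z i) B = normal_prob 0 1 B.

Definition KL_sum n (mu : n.-tuple R -> R) (lam : nat -> R)
    (Z : nat -> {RV P >-> R}) (e : nat -> n.-tuple R -> R) (N : nat)
    (x : n.-tuple R) (w : T) : R :=
  mu x + \sum_(i < N) Num.sqrt (lam i) * Z i w * e i x.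

(* W = mu + sum_i sqrt(lam_i) Z_i e_i, the series converging in L^2(P) at each
   point of D. *)
Definition KL_expansion n (D : set (n.-tuple R)) (mu : n.-tuple R -> R)
    (lam : nat -> R) (Z : nat -> {RV P >-> R}) (e : nat -> n.-tuple R -> R)
    (W : n.-tuple R -> {RV P >-> R}) : Prop :=
  forall x, D x ->
    'E_P[fun w => ((W x w - KL_sum mu lam Z e N x w) ^+ 2)%R]%E
      @[N --> \oo] --> 0%E.

End gaussian_field.

(* Main.v *)
(* Only the independence of [l] and [W] is assumed, so the key point is that
   the truncated expansion [W^N x] is, up to a null set, a function of [W]: it
   lies in the closed linear span of the centered field.  Let [h] be the
   residual of a near-minimizer of the distance from [W^N x - mu x] to that
   span.  Then [E (h V(y))] is uniformly small in [y], where [V = W - mu]; since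
   [E (h V(y)) = sum_i sqrt(lam_i) E (h Z_i) e_i(y)], orthonormality makes each
   [sqrt(lam_i) E (h Z_i)] small, so [h] itself is small.  Being an L^2 limit of
   Gaussian variables independent of [l], [W^N x] is Gaussian and independent
   of [l].

   Part (1) follows by approximating the random time from the right by times in
   a grid, where independence turns the expectation into a finite mixture, and
   letting the mesh tend to 0; in part (2) the process is already constant on
   the grid cells. *)
Require Import Defs.
From HB Require Import structures.
From mathcomp Require Import all_boot all_order all_algebra.
From mathcomp Require Import complex.
From mathcomp Require Import all_classical all_reals all_analysis.
From mathcomp Require Import measurable_realfun ring lra.

Set Implicit Arguments.
Unset Strict Implicit.
Unset Printing Implicit Defensive.

Import Order.TTheory GRing.Theory Num.Theory.
Import numFieldNormedType.Exports.

Local Open Scope classical_set_scope.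
Local Open Scope ring_scope.
Local Open Scope complex_scope.

(** The classical formula recovers [Z i] as the integral of V e_i over the cube divided by
    sqrt(lam_i); it needs pathwise integrals of the field and breaks down at lam_i = 0, where [Z i]
    does not enter the expansion. Testing against a fixed h first leaves only the deterministic
    function y |-> E (h V(y)) to integrate, and only the products sqrt(lam_i) E (h Z_i) are
    controlled, so zero eigenvalues are harmless. A near-minimizer does the work of the orthogonal
    projection without completeness of L^2: slack delta in the minimization gives E (h p)^2 <= delta
    E (p^2) for all p in the span, and this is uniform over the field because mean-square continuity
    bounds its second moments on the compact cube.

    Law and independence of W^N are one statement, proved for an arbitrary event A independent of W:
    P(A, W^N(x) in B) is P(A) times a normal mass of B. The whole space gives the law, an event of
    [l] gives independence. Since an L^2 limit does not control events, the statement is first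
    proved with a Lipschitz function in place of the indicator of B. *)

(** * Integrals of real-valued functions *)

Section real_integrals.
Context d (T : measurableType d) (R : realType).
Implicit Types (mu : {measure set T -> \bar R}) (D : set T) (f g : T -> R).

Lemma Rintegral_dominated_cvg mu D (f_ : nat -> T -> R) f g :
  measurable D ->
  (forall n, measurable_fun D (f_ n)) ->
  (forall x, D x -> f_ ^~ x @ \oo --> f x) ->
  mu.-integrable D (EFin \o g) ->
  (forall n x, D x -> `|f_ n x| <= g x) ->
  mu.-integrable D (EFin \o f) /\
  \int[mu]_(x in D) f_ n x @[n --> \oo] --> \int[mu]_(x in D) f x.
Proof.
move=> mD mf_ f_f ig f_g.
have mf : measurable_fun D f by exact: measurable_fun_cvg f_f.
have [] := @dominated_convergence _ _ _ mu D mD (fun n => EFin \o f_ n)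
  (EFin \o f) (EFin \o g).
- by move=> n; exact/measurable_EFinP.
- exact/measurable_EFinP.
- by apply: aeW => x Dx; apply: cvg_EFin; [exact: nearW|exact: f_f].
- exact: ig.
- by apply: aeW => x n Dx; rewrite lee_fin f_g.
move=> intf _ cvgf; split=> //.
apply: fine_cvg; rewrite /Rintegral fineK; first exact: cvgf.
exact: integrable_fin_num.
Qed.

Lemma bounded_integrable mu D f (C : R) : measurable D -> (mu D < +oo)%E ->
  measurable_fun D f -> (forall x, D x -> `|f x| <= C) ->
  mu.-integrable D (EFin \o f).
Proof.
move=> mD muD mf fC; apply: measurable_bounded_integrable => //.
exists C; split; first exact: num_real.
by move=> M CM x Dx; rewrite /= (le_trans (fC x Dx))// ltW.
Qed.

Lemma bounded_integrable_probability (P : probability T R) D f (C : R) :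
  measurable D -> measurable_fun D f -> (forall x, D x -> `|f x| <= C) ->
  P.-integrable D (EFin \o f).
Proof.
move=> mD mf fC; apply: bounded_integrable mf fC => //.
by rewrite (le_lt_trans (probability_le1 _ _))// ltry.
Qed.

Lemma Rintegral_sum mu D (I : Type) (s : seq I) (f : I -> T -> R) :
  measurable D -> (forall i, mu.-integrable D (EFin \o f i)) ->
  mu.-integrable D (EFin \o (fun x => \sum_(i <- s) f i x)) /\
  \int[mu]_(x in D) (\sum_(i <- s) f i x) =
  \sum_(i <- s) \int[mu]_(x in D) f i x.
Proof.
move=> mD fi; elim: s => [|i s [ih1 ih2]].
  rewrite big_nil (_ : EFin \o _ = cst 0%E); last first.
    by apply/funext => x /=; rewrite big_nil.
  split; first exact: integrable0.
  by under eq_Rintegral do rewrite big_nil; rewrite Rintegral_cst// mul0r.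
rewrite big_cons; under eq_Rintegral do rewrite big_cons.
rewrite RintegralD// ih2; split=> //.
rewrite (_ : EFin \o _ =
    (fun x => (f i x)%:E + (\sum_(j <- s) f j x)%R%:E)%E).
  exact: (integrableD mD (fi i) ih1).
by apply/funext => x /=; rewrite big_cons EFinD.
Qed.

End real_integrals.

(** * Lipschitz functions determine finite measures on the line *)

Section lipschitz_test_functions.
Context (R : realType).

(** For such g the difference of E g(X) and E g(Y) is at most K E |X - Y|, so identities between
    expectations pass to L^1 limits; the values in [0, 1] provide domination and nonnegativity for
    free. *)
Definition lipschitz_test (g : R -> R) :=
  (forall x, 0 <= g x <= 1) /\
  exists2 K, 0 <= K & forall x y, `|g x - g y| <= K * `|x - y|.

Lemma lipschitz_test_continuous g : lipschitz_test g -> continuous g.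
Proof.
move=> [_ [K K0 gK]] x; apply/cvgrPdist_lt => e e0.
have K1 : 0 < K + 1 by rewrite ltr_wpDl.
near=> y; rewrite (le_lt_trans (gK _ _))//.
rewrite (@le_lt_trans _ _ ((K + 1) * `|x - y|))//.
  by rewrite ler_wpM2r// lerDl.
rewrite mulrC -ltr_pdivlMr//.
near: y; apply: cvgr_dist_lt; [exact: cvg_id|exact: divr_gt0].
Unshelve. all: by end_near. Qed.

Lemma lipschitz_test_measurable g : lipschitz_test g -> measurable_fun setT g.
Proof.
by move=> /lipschitz_test_continuous cg; exact: continuous_measurable_fun.
Qed.

(** Continuous approximation of the indicator of the open half-line beyond a: it vanishes up to a,
    then rises to 1 with slope n. *)
Definition ramp (a : R) (n : nat) (x : R) : R :=
  Num.min 1 (Num.max 0 (n%:R * (x - a))).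

Lemma ramp_test a n : lipschitz_test (ramp a n).
Proof.
split=> [x|].
  by rewrite /ramp ge_min lexx/= le_min ler01/= le_max lexx.
exists n%:R => // x y; rewrite /ramp.
have -> : n%:R * `|x - y| = `|n%:R * (x - a) - n%:R * (y - a)|.
  by rewrite -mulrBr normrM ger0_norm// opprB addrA subrK.
set u := _ * (x - a); set v := _ * (y - a).
rewrite /Num.min /Num.max; clearbody u v.
case: (ltP 0 u) => hu; case: (ltP 0 v) => hv;
  [case: (ltP 1 u) => hu1; case: (ltP 1 v) => hv1 | case: (ltP 1 u) => hu1;
   rewrite ?ltr10 | case: (ltP 1 v) => hv1; rewrite ?ltr10 | rewrite ?ltr10];
  case: (ger0P (u - v)) => huv;
  first [exact: lexx | rewrite ler_norml; apply/andP; split; lra].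
Qed.

Lemma ramp_cvg a x : ramp a ^~ x @ \oo --> (\1_(`]a, +oo[) x : R).
Proof.
have [ax|xa] := ltP a x; last first.
  rewrite indicE memNset; last by rewrite /= in_itv/= andbT; apply/negP; rewrite -leNgt.
  apply: cvg_near_cst; apply: nearW => n; rewrite /ramp.
  rewrite max_l ?mulr_ge0_le0 ?subr_le0//.
  by rewrite min_r.
rewrite indicE mem_set; last by rewrite /= in_itv/= ax.
apply: cvg_near_cst; near=> n; rewrite /ramp min_l// le_max.
apply/orP; right; rewrite -ler_pdivrMr ?subr_gt0// div1r.
near: n; exact: nbhs_infty_ger.
Unshelve. all: by end_near. Qed.

(** Open half-lines are stable under intersection and generate the Borel sets, and the mass of each
    is the limit of integrals of ramps. Finiteness makes the constant 1 a dominating function. *)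
Lemma lipschitz_measure_unique (m1 m2 : {measure set R -> \bar R}) :
  (m1 setT < +oo)%E -> (m2 setT < +oo)%E ->
  (forall g, lipschitz_test g -> \int[m1]_x g x = \int[m2]_x g x) ->
  forall A, measurable A -> m1 A = m2 A.
Proof.
move=> m1oo m2oo m12.
move=> A mA; apply: (@measure_unique _ _ R [set A | exists x, A = `]x, +oo[%classic]
  (fun n => `](- n%:R), +oo[%classic)).
- exact: RGenOInfty.measurableE.
- move=> _ _ [a ->] [b ->]; exists (Num.max a b).
  by apply/seteqP; split=> x /=; rewrite !in_itv/= !andbT gt_max;
    [move=> [-> ->]|move/andP].
- by move=> i; exists (- i%:R).
- apply/seteqP; split=> // x _; exists (Num.bound `|x|) => //=.
  rewrite in_itv/= andbT ltrNl (le_lt_trans (ler_norm _))// normrN.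
  by rewrite archi_boundP.
- move=> _ [a ->].
  have key (m : {measure set R -> \bar R}) : (m setT < +oo)%E ->
      \int[m]_x ramp a n x @[n --> \oo] --> fine (m `]a, +oo[%classic).
    move=> moo.
    have [] := @Rintegral_dominated_cvg _ _ _ m setT (ramp a) (\1_(`]a, +oo[))
      (cst 1) measurableT.
    - by move=> n; apply: lipschitz_test_measurable; exact: ramp_test.
    - by move=> x _; exact: ramp_cvg.
    - by apply: bounded_integrable (1) _ _ _ _ => // x _; rewrite normr1.
    - move=> n x _; have [/(_ x)/andP[r0 r1] _] := ramp_test a n.
      by rewrite ger0_norm.
    by move=> _; rewrite /Rintegral integral_indic// setIT.
  have fin (m : {measure set R -> \bar R}) : (m setT < +oo)%E ->
      m `]a, +oo[%classic \is a fin_num.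
    move=> moo; rewrite ge0_fin_numE//; apply: le_lt_trans moo.
    by apply: le_measure; rewrite ?inE.
  rewrite -(fineK (fin m1 m1oo)) -(fineK (fin m2 m2oo)); congr EFin.
  have := key _ m1oo; under eq_fun do rewrite (m12 _ (ramp_test a _)).
  by move/cvg_lim => <-//; have /cvg_lim <- := key _ m2oo.
- by move=> k; apply: le_lt_trans m1oo; apply: le_measure; rewrite ?inE.
- exact: mA.
Qed.

End lipschitz_test_functions.

(** * Independence of an event and a random variable, in integral form *)

Section independence_integrals.
Context d (T : measurableType d) (R : realType) (P : probability T R).

Lemma ge0_integral_mrestr (A : set T) (mA : measurable A) (f : T -> \bar R) :
  measurable_fun setT f -> (forall w, 0 <= f w)%E ->
  (\int[mrestr P mA]_w f w = \int[P]_(w in A) f w)%E.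
Proof.
move=> mf f0; rewrite -(setUv A) ge0_integral_setU//=.
- rewrite [X in (_ + X)%E]null_set_integral ?adde0//.
  + by apply: eq_measure_integral => B mB BA; rewrite /= /mrestr setIidl.
  + exact: measurableC.
  + exact: measurable_funTS.
  + by rewrite -[LHS]/(P (~` A `&` A)) setICl measure0.
- exact: measurableC.
- by rewrite setUv.
- exact/disj_setPCl.
Qed.

(** Both sides integrate g against a measure on the line: the image under X of P restricted to A,
    and P(A) times the image of P. Independence says that these two measures coincide, so no
    approximation by simple functions is needed. *)
Lemma indep_ge0_integral (A : set T) (X : T -> R) (g : R -> R) :
  measurable A -> measurable_fun setT X -> measurable_fun setT g ->
  (forall x, 0 <= g x) ->
  (forall B, measurable B -> P (A `&` X @^-1` B) = (P A * P (X @^-1` B))%E) ->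
  (\int[P]_(w in A) (g (X w))%:E = P A * \int[P]_w (g (X w))%:E)%E.
Proof.
move=> mA mX mg g0 AX.
have mgE : measurable_fun setT (EFin \o g) by exact/measurable_EFinP.
have fA : fine (P A) = (NngNum (fine_ge0 (measure_ge0 P A)))%:num by [].
have -> : P A = (fine (P A))%:E by rewrite fineK// fin_num_measure.
have -> : (\int[P]_(w in A) (g (X w))%:E =
           \int[pushforward (mrestr P mA) X]_y (g y)%:E)%E.
  rewrite ge0_integral_pushforward//=; last by move=> y _; rewrite lee_fin.
  rewrite preimage_setT ge0_integral_mrestr//.
    exact: measurableT_comp mgE mX.
  by move=> w; rewrite lee_fin.
rewrite (_ : (\int[P]_w _)%E = (\int[pushforward P X]_y (g y)%:E)%E); last first.
  by rewrite ge0_integral_pushforward//=; move=> y _; rewrite lee_fin.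
rewrite fA -ge0_integral_mscale//; last by move=> y _; rewrite lee_fin.
apply: eq_measure_integral => B mB _.
rewrite /= /mscale/= /pushforward /mrestr setIC AX//.
by rewrite fineK// fin_num_measure.
Qed.

Lemma indep_integral (A : set T) (X : T -> R) (g : R -> R) (C : R) :
  measurable A -> measurable_fun setT X -> measurable_fun setT g ->
  (forall x, `|g x| <= C) ->
  (forall B, measurable B -> P (A `&` X @^-1` B) = (P A * P (X @^-1` B))%E) ->
  \int[P]_(w in A) g (X w) = fine (P A) * \int[P]_w g (X w).
Proof.
move=> mA mX mg gC AX.
have finP B : measurable B -> (P B < +oo)%E.
  by move=> mB; rewrite (le_lt_trans (probability_le1 _ _))// ltry.
have mgX B : measurable_fun B (fun w => g (X w)).
  exact: measurable_funTS (measurableT_comp mg mX).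
have igX B : measurable B -> P.-integrable B (EFin \o (fun w => g (X w))).
  by move=> mB; apply: (bounded_integrable (C := C)) => //; exact: finP.
have iC B : measurable B -> P.-integrable B (EFin \o cst C).
  move=> mB; apply: (bounded_integrable (C := `|C|)) => //; exact: finP.
have PT : fine (P setT) = 1 by rewrite probability_setT.
(* Shifting by the bound C reduces to the nonnegative case; the contribution C P(A) of the constant
   cancels at the end. *)
have gC0 x : 0 <= g x + C by have := gC x; rewrite ler_norml; lra.
have := indep_ge0_integral mA mX (measurable_funD mg (measurable_cst C)) gC0 AX.
move=> /(congr1 fine); rewrite fineM; last 2 first.
- exact: fin_num_measure.
- apply: (@integrable_fin_num _ _ _ P setT measurableT
    (EFin \o (fun w => g (X w) + C))).
  apply: (bounded_integrable (C := `|C| + C)) => //; first exact: finP.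
    exact: measurable_funD.
  move=> x _; rewrite ger0_norm// lerD2r (le_trans (ler_norm _))//.
  by rewrite (le_trans (gC _))// ler_norm.
rewrite -!/(Rintegral _ _ _) (RintegralD mA (igX _ mA) (iC _ mA)).
rewrite (RintegralD measurableT (igX _ measurableT) (iC _ measurableT)).
rewrite !Rintegral_cst// PT mulr1 mulrDr (mulrC C).
by move/addIr.
Qed.

End independence_integrals.

(** * The normal law as an affine image of the standard one, and its first two moments *)

Section normal_distribution.
Context (R : realType).
Local Notation N01 := (@normal_prob R 0 1).

(** Gaussian laws are handled as images of N(0, 1) under this map, which for s = 0 yields the point
    mass at m; degenerate variables then need no separate treatment. *)
Definition affine (m s z : R) : R := m + s * z.

Lemma affine_continuous m s : continuous (affine m s).
Proof.
by move=> z; apply: cvgD; [exact: cvg_cst|apply: cvgM; [exact: cvg_cst|exact: cvg_id]].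
Qed.

Lemma measurable_affine m s : measurable_fun setT (affine m s).
Proof. by apply: continuous_measurable_fun; exact: affine_continuous. Qed.

(** The Radon-Nikodym derivative of the normal law and the explicit density have the same integral
    over every measurable set, hence agree almost everywhere. *)
Lemma ge0_integral_normal_prob m s (f : R -> R) : measurable_fun setT f ->
  (forall x, 0 <= f x) ->
  (\int[normal_prob m s]_x (f x)%:E =
   \int[lebesgue_measure]_x (f x * normal_pdf m s x)%:E)%E.
Proof.
move=> mf f0.
have mfE : measurable_fun setT (EFin \o f) by exact/measurable_EFinP.
have mp : measurable_fun setT (EFin \o normal_pdf m s).
  by apply/measurable_EFinP; exact: measurable_normal_pdf.
rewrite -(Radon_Nikodym_SigmaFinite.change_of_variables
  (normal_prob_dominates m s))//.
apply: ae_eq_integral => //.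
- apply: emeasurable_funM => //; apply: (measurable_int lebesgue_measure).
  exact: Radon_Nikodym_SigmaFinite.f_integrable (normal_prob_dominates m s).
- under eq_fun do rewrite EFinM; exact: emeasurable_funM.
- under [X in ae_eq _ _ _ X]eq_fun do rewrite EFinM.
  apply: ae_eqe_mul2l; apply: integral_ae_eq => //.
    exact: Radon_Nikodym_SigmaFinite.f_integrable (normal_prob_dominates m s).
  move=> A _ mA.
  by rewrite -(Radon_Nikodym_SigmaFinite.f_integral (normal_prob_dominates m s)).
Qed.

Lemma integral_normal_affine m s (g : R -> R) : 0 < s -> continuous g ->
  (forall x, 0 <= g x) ->
  (\int[normal_prob m s]_x (g x)%:E =
   \int[N01]_z (g (affine m s z))%:E)%E.
Proof.
move=> s0 cg g0.
have mg : measurable_fun setT g by exact: continuous_measurable_fun.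
have mga : measurable_fun setT (fun z => g (affine m s z)).
  exact: measurableT_comp mg (measurable_affine m s).
rewrite (ge0_integral_normal_prob m s mg g0).
rewrite (ge0_integral_normal_prob 0 1 mga (fun z => g0 _)).
have dF : (affine m s)^`()%classic = cst s.
  apply/funext => z; rewrite /affine derive1E deriveD// derive_cst add0r.
  by rewrite deriveM// derive_id derive_cst scaler0 addr0 scaler1.
have affE : affine m s = fun z => (z - - (m / s)) * s.
  by apply/funext => z; rewrite /affine opprK; field; rewrite gt_eqF.
rewrite (@increasing_ge0_integration_by_substitutionT _ (affine m s)).
- apply: eq_integral => z _; congr EFin; rewrite dF.
  rewrite -[LHS]/(g (affine m s z) * normal_pdf m s (affine m s z) * s).
  (* What remains is that the Jacobian s cancels the 1/s in the peak of the density with parameters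
     m and s. *)
  rewrite -mulrA; congr (_ * _).
  rewrite !normal_pdfE ?oner_neq0 ?gt_eqF// /normal_fun mulrAC; congr (_ * expR _).
    rewrite /normal_peak expr1n mul1r -[s ^+ 2 * pi *+ 2]mulrnAr.
    rewrite sqrtrM ?sqr_ge0// sqrtr_sqr gtr0_norm// invfM mulrAC mulVf ?mul1r//.
    by rewrite gt_eqF.
  rewrite /affine addrC addKr subr0 expr1n exprMn -mulrnAr !mulNr.
  by congr (- _); field; rewrite gt_eqF.
- by move=> x y xy; rewrite /affine ltrD2l ltr_pM2l.
- by rewrite dF => ?; exact: cvg_cst.
- by rewrite dF; exact: is_cvg_cst.
- by rewrite dF; exact: is_cvg_cst.
- by move=> z; rewrite /affine; exact: derivableD.
- rewrite affE; apply/gt0_cvgMlNy => //; exact: cvg_addrr_Ny.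
- rewrite affE; apply/gt0_cvgMly => //; exact: cvg_addrr.
- move=> z; apply: cvgM; first exact: cg.
  by apply: continuous_normal_pdf; rewrite gt_eqF.
- by move=> z; rewrite mulr_ge0// normal_pdf_ge0.
Qed.

Lemma normal_prob_abs m s : normal_prob m `|s| = normal_prob m s :> (set R -> \bar R).
Proof.
apply/funext => A; rewrite /normal_prob; apply: eq_integral => x _.
rewrite /normal_pdf normr_eq0 /normal_peak /normal_fun.
by rewrite real_normK ?num_real.
Qed.

Lemma normal_probE m s (A : set R) : s != 0 -> measurable A ->
  normal_prob m s A = N01 (affine m `|s| @^-1` A).
Proof.
move=> s0 mA; rewrite -normal_prob_abs.
have ns : 0 < `|s| by rewrite normr_gt0.
have maff : measurable_fun [set: measurableTypeR R] (affine m `|s| : _ -> R).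
  exact: measurable_affine.
(* Pushing forward along the identity only moves the measure from [measurableTypeR R] to [R], where
   the uniqueness lemma is stated. *)
have mid : measurable_fun [set: measurableTypeR R] (idfun : measurableTypeR R -> R).
  exact: measurable_id.
have := @lipschitz_measure_unique R
  (measure_function_pushforward__canonical__measure_function_Measure
     (normal_prob m `|s|) mid)
  (measure_function_pushforward__canonical__measure_function_Measure N01 maff).
apply; last exact: mA.
- by rewrite /= /pushforward preimage_setT probability_setT ltry.
- by rewrite /= /pushforward preimage_setT probability_setT ltry.
- move=> g gt; have [g01 _] := gt.
  have g0 x : 0 <= g x by have /andP[] := g01 x.
  have mg : measurable_fun setT (EFin \o g).
    by apply/measurable_EFinP; exact: lipschitz_test_measurable.
  apply: (congr1 fine).
  have g0E : {in [set: R], forall y, 0 <= (EFin \o g) y}%E.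
    by move=> y _; rewrite lee_fin.
  have e1 := @ge0_integral_pushforward _ _ _ _ R _ mid
    (normal_prob m `|s|) setT _ measurableT mg g0E.
  have e2 := @ge0_integral_pushforward _ _ _ _ R _ maff N01 setT _ measurableT mg g0E.
  rewrite !preimage_setT in e1 e2; apply: (etrans e1 (etrans _ (esym e2))).
  by apply: integral_normal_affine => //; exact: lipschitz_test_continuous.
Qed.

Lemma is_derive_std_normal_pdf (z : R) :
  is_derive z 1 (normal_pdf 0 1) (- z * normal_pdf 0 1 z).
Proof.
rewrite normal_pdfE ?oner_neq0// /normal_fun.
have -> : (fun x : R => normal_peak 1 * expR (- (x - 0) ^+ 2 / (1 ^+ 2 *+ 2))) =
          (fun x => normal_peak 1 * expR (- 2^-1 * x ^+ 2)).
  by apply/funext => x; congr (_ * expR _); rewrite subr0 expr1n; lra.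
apply: is_derive_eq.
rewrite /GRing.scale/=; set e := expR _.
have -> : expR (- (z - 0) ^+ 2 / (1 ^+ 2 *+ 2)) = e.
  by congr expR; rewrite subr0 expr1n; lra.
first [lra|by field|nra].
Qed.

Lemma continuous_std_normal_pdf : continuous (@normal_pdf R 0 1).
Proof. by apply: continuous_normal_pdf; rewrite oner_neq0. Qed.

Let p := @normal_pdf R 0 1.
Let p0 z : 0 <= p z := normal_pdf_ge0 0 1 z.

(** Since p' = - z p, the function z p is a primitive of (1 - z^2) p: this compares the second
    moment with the total mass 1. *)
Let is_derive_zp (z : R) : is_derive z 1 (fun z => z * p z) (p z - z ^+ 2 * p z).
Proof.
have dp := is_derive_std_normal_pdf z.
apply: is_derive_eq.
by rewrite /GRing.scale/= -/p; lra.
Qed.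

Let cont_zp : continuous (fun z : R => z * p z).
Proof.
by move=> z; apply: cvgM; [exact: cvg_id|exact: continuous_std_normal_pdf].
Qed.

Let cont_z2p : continuous (fun z : R => z ^+ 2 * p z).
Proof.
by move=> z; apply: cvgM; [exact: exprn_continuous|exact: continuous_std_normal_pdf].
Qed.

Let zp_cvg0 : z * p z @[z --> +oo] --> (0 : R).
Proof.
have peak0 : 0 <= @normal_peak R 1 by exact: normal_peak_ge0.
have h : (normal_peak 1 * 2) * z^-1 @[z --> +oo] --> (0 : R).
  rewrite -(mulr0 (normal_peak 1 * 2)); apply: cvgM; first exact: cvg_cst.
  apply/gtr0_cvgV0; last exact: cvg_id.
  exact: nbhs_pinfty_gt.
apply: (squeeze_cvgr _ (cvg_cst 0) h); near=> z.
have z0 : 0 < z by near: z; exact: nbhs_pinfty_gt.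
apply/andP; split; first by rewrite mulr_ge0// ltW.
rewrite /p normal_pdfE ?oner_neq0//= /normal_fun.
rewrite mulrCA -[X in _ <= X]mulrA ler_wpM2l// subr0 expr1n.
(* From exp u >= 1 + u at u = z^2 / 2; this much decay already gives z p(z) <= 2 p(0) / z. *)
have e : expR (- z ^+ 2 / (1 *+ 2)) <= (1 + z ^+ 2 / 2)^-1.
  rewrite mulNr expRN lef_pV2 ?posrE ?expR_gt0//; last first.
    by rewrite ltr_wpDr// mulr_ge0// sqr_ge0.
  by rewrite (le_trans (expR_ge1Dx _))//.
rewrite (le_trans (ler_wpM2l (ltW z0) e))//.
rewrite ler_pdivrMr; last by rewrite ltr_wpDr// mulr_ge0// sqr_ge0.
rewrite -ler_pdivrMl; last by rewrite mulr_gt0// invr_gt0.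
rewrite invfM invrK -mulrA -expr2.
have : 0 <= z ^+ 2 by exact: sqr_ge0.
lra.
Unshelve. all: by end_near. Qed.

Let mu := @lebesgue_measure R.

(** The half-line is cut at 1, where 1 - z^2 changes sign, so that each piece has an integrand of
    constant sign. The boundary term p(1) appears here and in [head_moment] on opposite sides and
    cancels in the sum. *)
Let tail_moment :
  (\int[mu]_(z in `[1%R, +oo[) (z ^+ 2 * p z)%:E =
   (p 1)%:E + \int[mu]_(z in `[1%R, +oo[) (p z)%:E)%E.
Proof.
have f0 z : 1 <= z -> 0 <= z ^+ 2 * p z - p z.
  move=> z1; rewrite -{2}(mul1r (p z)) -mulrBl mulr_ge0// subr_ge0.
  by rewrite -(expr1n _ 2) lerXn2r ?nnegrE// (le_trans _ z1).
have cf : continuous (fun z : R => z ^+ 2 * p z - p z).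
  by move=> z; apply: cvgB; [exact: cont_z2p|exact: continuous_std_normal_pdf].
have mp : measurable_fun (`[1%R, +oo[ : set R) (EFin \o p).
  by apply/measurable_EFinP/measurable_funTS; exact: measurable_normal_pdf.
have mf : measurable_fun (`[1%R, +oo[ : set R) (EFin \o (fun z => z ^+ 2 * p z - p z)).
  by apply/measurable_EFinP/measurable_funTS; exact: continuous_measurable_fun.
have := @ge0_continuous_FTC2y _ (fun z => z ^+ 2 * p z - p z)
  (fun z => - (z * p z)) 1 0 f0 (continuous_subspaceT cf).
rewrite -EFinB sub0r opprK mul1r => <-; first last.
- move=> z _; rewrite derive1E; apply: derive_val.
  by apply: is_derive_eq; [exact: is_deriveN (is_derive_zp z)|rewrite opprB].
- apply: cvg_at_right_filter.
  rewrite -[X in - X]mul1r; exact: (cvgN (@cont_zp 1)).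
- by move=> z _; apply: derivableN; have [] := is_derive_zp z.
- by rewrite -oppr0; apply: cvgN.
rewrite -ge0_integralD//=.
- by apply: eq_integral => z _; rewrite -EFinD subrK.
- by move=> z; rewrite in_itv/= andbT => z1; apply: f0.
- by move=> z _; rewrite lee_fin.
Qed.

Let head_moment :
  (\int[mu]_(z in `[0%R, 1%R]) (p z)%:E =
   (p 1)%:E + \int[mu]_(z in `[0%R, 1%R]) (z ^+ 2 * p z)%:E)%E.
Proof.
have f0 z : 0 <= z <= 1 -> 0 <= p z - z ^+ 2 * p z.
  move=> /andP[z0 z1]; rewrite -{1}(mul1r (p z)) -mulrBl mulr_ge0// subr_ge0.
  by rewrite -(expr1n _ 2) lerXn2r ?nnegrE.
have cf : continuous (fun z : R => p z - z ^+ 2 * p z).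
  by move=> z; apply: cvgB; [exact: continuous_std_normal_pdf|exact: cont_z2p].
have mp : measurable_fun (`[0%R, 1%R] : set R) (EFin \o (fun z => z ^+ 2 * p z)).
  by apply/measurable_EFinP/measurable_funTS; exact: continuous_measurable_fun.
have mf : measurable_fun (`[0%R, 1%R] : set R) (EFin \o (fun z => p z - z ^+ 2 * p z)).
  by apply/measurable_EFinP/measurable_funTS; exact: continuous_measurable_fun.
have := @continuous_FTC2 _ (fun z => p z - z ^+ 2 * p z)
  (fun z => z * p z) 0 1 ltr01 (continuous_subspaceT cf).
rewrite mul0r mul1r oppe0 adde0 => <-; first last.
- by move=> z _; rewrite derive1E; apply: derive_val; exact: is_derive_zp.
- split.
  + by move=> z _; have [] := is_derive_zp z.
  + exact: cvg_at_right_filter (@cont_zp 0).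
  + exact: cvg_at_left_filter (@cont_zp 1).
rewrite -ge0_integralD//=.
- by apply: eq_integral => z _; rewrite -EFinD subrK.
- by move=> z _; rewrite lee_fin mulr_ge0// sqr_ge0.
Qed.

Let half_line (f : R -> R) : continuous f -> (forall x, 0 <= f x) ->
  (\int[mu]_(z in [set z | (0 <= z)%R]) (f z)%:E =
   \int[mu]_(z in `[0%R, 1%R]) (f z)%:E + \int[mu]_(z in `[1%R, +oo[) (f z)%:E)%E.
Proof.
move=> cf f0; have mf : measurable_fun setT (EFin \o f).
  by apply/measurable_EFinP; exact: continuous_measurable_fun.
have -> : [set z : R | 0 <= z] = `[0, 1] `|` `]1, +oo[.
  apply/seteqP; split=> z /=; rewrite !in_itv/= !andbT.
    by move=> z0; have [z1|z1] := leP z 1; [left; apply/andP|right].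
  by move=> [/andP[]//|/ltW]; exact: le_trans.
rewrite ge0_integral_setU//=.
- by rewrite (@integral_itv_obnd_cbnd)//; exact: measurable_funTS.
- exact: measurable_funTS.
- by move=> z _; rewrite lee_fin.
- rewrite disj_set2E; apply/eqP/seteqP; split=> z //=; rewrite !in_itv/= andbT.
  by move=> [/andP[_ z1]]; rewrite ltNge z1.
Qed.

Lemma std_normal_second_moment : (\int[N01]_z (z ^+ 2)%:E = 1)%E.
Proof.
have mf : measurable_fun [set: R] (fun z : R => z ^+ 2).
  by apply: continuous_measurable_fun; exact: exprn_continuous.
rewrite ge0_integral_normal_prob//; last by move=> z; exact: sqr_ge0.
have peven : p =1 p \o -%R.
  by move=> z; rewrite /p normal_pdfE ?oner_neq0//= /normal_fun !subr0 sqrrN.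
rewrite ge0_symfun_integralT; first last.
- by move=> z /=; rewrite sqrrN; congr (_ * _); exact: peven.
- exact: cont_z2p.
- by move=> z; rewrite mulr_ge0// sqr_ge0.
rewrite -(integral_normal_pdf (0 : R) 1).
rewrite ge0_symfun_integralT//; last exact: continuous_std_normal_pdf.
congr (_ * _)%E.
rewrite half_line//; last by move=> z; rewrite mulr_ge0// sqr_ge0.
rewrite half_line//; last exact: continuous_std_normal_pdf.
by rewrite tail_moment head_moment addeCA addeA.
Qed.

Lemma std_normal_integrable_sqr : N01.-integrable setT (EFin \o (fun z : R => z ^+ 2)).
Proof.
apply/integrableP; split.
  apply/measurable_EFinP; apply: continuous_measurable_fun; exact: exprn_continuous.
under eq_integral do rewrite /= ger0_norm ?sqr_ge0//.
by rewrite std_normal_second_moment ltry.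
Qed.

Lemma std_normal_integrable_id : N01.-integrable setT (EFin \o (fun z : R => z)).
Proof.
have i1 : N01.-integrable setT (EFin \o (fun z : R => 1 + z ^+ 2)).
  rewrite (_ : _ \o _ = (fun z : R => (1 : R)%:E + (z ^+ 2)%R%:E)%E)//.
  apply: integrableD => //; last exact: std_normal_integrable_sqr.
  apply: (@bounded_integrable_probability _ _ _ N01 setT (cst 1) 1) => // z _.
  by rewrite normr1.
apply: (le_integrable measurableT _ _ i1); first exact/measurable_EFinP.
move=> z _; rewrite /= lee_fin [leRHS]ger0_norm; last first.
  by rewrite addr_ge0// sqr_ge0.
have := sqr_ge0 (`|z| - 1); rewrite sqrrB1 real_normK ?num_real// => h.
have := normr_ge0 z; lra.
Qed.

(** Only nonnegative even functions are folded onto the half-line: by evenness E |z| is twice the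
    mean of the positive part, and it is also the sum of the means of both parts, so these means
    agree. *)
Lemma std_normal_mean : \int[N01]_z z = 0.
Proof.
pose pos (z : R) := Num.max z 0; pose neg (z : R) := Num.max (- z) 0.
have pos0 z : 0 <= pos z by rewrite le_max lexx orbT.
have neg0 z : 0 <= neg z by rewrite le_max lexx orbT.
have cpos : continuous pos.
  by move=> z; apply: continuous_max; [exact: cvg_id|exact: cvg_cst].
have cneg : continuous neg.
  by move=> z; apply: continuous_max; [exact: cvgN cvg_id|exact: cvg_cst].
have ipos : N01.-integrable setT (EFin \o pos).
  apply: le_integrable std_normal_integrable_id => //.
    by apply/measurable_EFinP; exact: continuous_measurable_fun.
  move=> z _; rewrite lee_fin ger0_norm// /pos /Num.max; case: ifPn => // _.
  exact: ler_norm.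
have ineg : N01.-integrable setT (EFin \o neg).
  apply: le_integrable std_normal_integrable_id => //.
    by apply/measurable_EFinP; exact: continuous_measurable_fun.
  move=> z _; rewrite lee_fin ger0_norm// /neg /Num.max; case: ifPn => // _.
  by rewrite -normrN ler_norm.
have peven : p =1 p \o -%R.
  by move=> z; rewrite /p normal_pdfE ?oner_neq0//= /normal_fun !subr0 sqrrN.
have posE : (\int[N01]_z (pos z)%:E =
    \int[mu]_(z in [set z | (0 <= z)%R]) (z * p z)%:E)%E.
  rewrite ge0_integral_normal_prob//; last exact: continuous_measurable_fun.
  rewrite [RHS]integral_mkcond; apply: eq_integral => z _.
  rewrite patchE; case: ifPn => [|/negP].
    by rewrite inE/= => z0; rewrite /pos max_l.
  by rewrite inE/= => /negP; rewrite -ltNge => /ltW z0; rewrite /pos max_r// mul0r.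
have sumE : (\int[N01]_z (pos z)%:E + \int[N01]_z (neg z)%:E =
             2%:E * \int[N01]_z (pos z)%:E)%E.
  rewrite -ge0_integralD//=; first last.
  - by apply/measurable_EFinP; exact: continuous_measurable_fun.
  - by move=> z _; rewrite lee_fin.
  - by apply/measurable_EFinP; exact: continuous_measurable_fun.
  - by move=> z _; rewrite lee_fin.
  have -> : (fun z => (pos z)%:E + (neg z)%:E)%E = EFin \o (@Num.norm R R).
    apply/funext => z /=; rewrite -EFinD /pos /neg /Num.max; congr EFin.
    by case: ltP => ?; case: ltP => ?; case: (ger0P z) => ?; lra.
  have mn : measurable_fun setT (@Num.norm R R) := @normr_measurable R setT.
  rewrite (ge0_integral_normal_prob 0 1 mn)//.
  rewrite ge0_symfun_integralT.
  - rewrite posE; congr (_ * _)%E; apply: eq_integral => z.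
    by rewrite inE/= => z0; rewrite ger0_norm.
  - by move=> z; rewrite mulr_ge0.
  - by move=> z; apply: cvgM; [exact: norm_continuous|exact: continuous_std_normal_pdf].
  - by move=> z /=; rewrite normrN; congr (_ * _); exact: peven.
have := congr1 fine sumE.
rewrite fineD ?integrable_fin_num// fineM ?integrable_fin_num//=.
rewrite -!/(Rintegral _ _ _) => h.
have -> : \int[N01]_z z = \int[N01]_z (pos z - neg z).
  apply: eq_Rintegral => z _; rewrite /pos /neg /Num.max.
  by case: ltP => ?; case: ltP => ?; lra.
by rewrite RintegralB//; lra.
Qed.

End normal_distribution.

(** * Square-integrable random variables and near-projection onto a span *)

Section L2_space.
Context d (T : measurableType d) (R : realType) (P : probability T R).
Implicit Types X Y Z : T -> R.

Definition L2 X := measurable_fun setT X /\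
  P.-integrable setT (EFin \o (fun w => X w ^+ 2)).

Definition dot X Y := \int[P]_w (X w * Y w).

Lemma L2_mul X Y : L2 X -> L2 Y ->
  P.-integrable setT (EFin \o (fun w => X w * Y w)).
Proof.
move=> [mX iX] [mY iY]; have iXY := integrableD measurableT iX iY.
apply: (le_integrable measurableT _ _ iXY).
  by apply/measurable_EFinP; exact: measurable_funM.
move=> w _; rewrite /= lee_fin [leRHS]ger0_norm; last first.
  by rewrite addr_ge0// sqr_ge0.
have := sqr_ge0 (X w - Y w); have := sqr_ge0 (X w + Y w).
by rewrite !expr2 ler_norml => h1 h2; apply/andP; split; nra.
Qed.

Lemma L2D X Y : L2 X -> L2 Y -> L2 (fun w => X w + Y w).
Proof.
move=> lX lY; have [mX iX] := lX; have [mY iY] := lY.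
split; first exact: measurable_funD.
have iXY := L2_mul lX lY.
rewrite (_ : _ \o _ = (fun w => (X w ^+ 2)%:E +
    ((Y w ^+ 2)%:E + ((X w * Y w)%:E + (X w * Y w)%:E)))%E); last first.
  by apply/funext => w /=; rewrite -!EFinD; congr EFin; ring.
by do 3![apply: integrableD => //].
Qed.

Lemma L2Z a X : L2 X -> L2 (fun w => a * X w).
Proof.
move=> [mX iX]; split; first exact: measurable_funM.
rewrite (_ : _ \o _ = (fun w => (a ^+ 2)%:E * (X w ^+ 2)%:E))%E; last first.
  by apply/funext => w /=; rewrite exprMn EFinM.
exact: integrableZl.
Qed.

Lemma L2B X Y : L2 X -> L2 Y -> L2 (fun w => X w - Y w).
Proof.
move=> lX lY; under eq_fun do rewrite -mulN1r; apply: L2D => //; exact: L2Z.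
Qed.

Lemma L2_cst c : L2 (cst c).
Proof.
split; first exact: measurable_cst.
apply: (@bounded_integrable_probability _ _ _ P setT (cst (c ^+ 2)) (c ^+ 2)) => //.
by move=> w _; rewrite /= ger0_norm// sqr_ge0.
Qed.

Lemma L2_sum (I : Type) (s : seq I) (X : I -> T -> R) :
  (forall i, L2 (X i)) -> L2 (fun w => \sum_(i <- s) X i w).
Proof.
move=> lX; elim: s => [|i s ih].
  by under eq_fun do rewrite big_nil; exact: L2_cst.
by under eq_fun do rewrite big_cons; exact: L2D.
Qed.

Lemma L2_integrable X : L2 X -> P.-integrable setT (EFin \o X).
Proof.
move=> lX; have := L2_mul lX (L2_cst 1).
by under [X in EFin \o X]eq_fun do rewrite mulr1.
Qed.

Lemma dotC X Y : dot X Y = dot Y X.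
Proof. by apply: eq_Rintegral => w _; rewrite mulrC. Qed.

Lemma dot_ge0 X : 0 <= dot X X.
Proof. by apply: Rintegral_ge0 => w _; rewrite -expr2 sqr_ge0. Qed.

Lemma dotZl a X Y : L2 X -> L2 Y -> dot (fun w => a * X w) Y = a * dot X Y.
Proof.
move=> lX lY; rewrite /dot -RintegralZl//; last exact: L2_mul.
by apply: eq_Rintegral => w _; rewrite mulrA.
Qed.

Lemma dotZr a X Y : L2 X -> L2 Y -> dot X (fun w => a * Y w) = a * dot X Y.
Proof. by move=> lX lY; rewrite dotC dotZl// dotC. Qed.

Lemma dotBl X Y Z : L2 X -> L2 Y -> L2 Z ->
  dot (fun w => X w - Y w) Z = dot X Z - dot Y Z.
Proof.
move=> lX lY lZ; rewrite /dot -RintegralB//; [|exact: L2_mul|exact: L2_mul].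
by apply: eq_Rintegral => w _; rewrite mulrBl.
Qed.

Lemma dot_suml (I : Type) (s : seq I) (X : I -> T -> R) Y :
  (forall i, L2 (X i)) -> L2 Y ->
  dot (fun w => \sum_(i <- s) X i w) Y = \sum_(i <- s) dot (X i) Y.
Proof.
move=> lX lY; have [_ <-] := Rintegral_sum s measurableT
  (fun i => L2_mul (lX i) lY).
by apply: eq_Rintegral => w _; rewrite mulr_suml.
Qed.

Lemma dotB2 X Y : L2 X -> L2 Y ->
  dot (fun w => X w - Y w) (fun w => X w - Y w) =
  dot X X - 2 * dot X Y + dot Y Y.
Proof.
move=> lX lY; rewrite dotBl//; last exact: L2B.
rewrite (dotC X) (dotC Y) !dotBl// (dotC Y X); ring.
Qed.

(** The discriminant of a nonnegative quadratic. The constant term is kept abstract because it is a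
    squared norm in [Cauchy_Schwarz] but the slack of a minimization in [near_projection]. *)
Lemma discriminant_le (delta b c : R) :
  (forall t, 0 <= delta - 2 * t * b + t ^+ 2 * c) -> b ^+ 2 <= delta * c.
Proof.
move=> h; have delta0 : 0 <= delta.
  by have := h 0; rewrite mulr0 mul0r expr0n/= mul0r subr0 addr0.
have [c0|c0|c0] := ltrgtP c 0.
(* For c < 0, adding the values at t and -t removes b and leaves delta + t^2 c >= 0; this t makes
   that quantity at most c, a contradiction. *)
- have := h (1 + delta / - c); have := h (- (1 + delta / - c)).
  set t := 1 + _ => h1 h2.
  have : t * - c = - c + delta by rewrite /t; field; lra.
  have : 1 <= t by rewrite lerDl divr_ge0//; lra.
  by move=> t1 tc; nra.
- have := h (b / c).
  rewrite (_ : _ + _ = delta - b ^+ 2 / c); last by field; rewrite gt_eqF.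
  by rewrite subr_ge0 ler_pdivrMr.
(* For c = 0 the function is affine in t, and if b is nonzero the t below gives it the value -1. *)
- rewrite c0 mulr0; have [->|b0] := eqVneq b 0; first by rewrite expr0n.
  have := h ((delta + 1) / (2 * b)); rewrite c0 mulr0 addr0.
  rewrite (_ : _ - _ = - 1); last by field.
  by rewrite ler0N1.
Qed.

Lemma Cauchy_Schwarz X Y : L2 X -> L2 Y ->
  dot X Y ^+ 2 <= dot X X * dot Y Y.
Proof.
move=> lX lY; apply: discriminant_le => t.
have := dot_ge0 (fun w => X w - t * Y w).
have lt := L2Z t lY.
by rewrite dotB2// dotZr// dotZl// dotZr// expr2; lra.
Qed.

Definition nrm X := Num.sqrt (dot X X).

Lemma nrm_ge0 X : 0 <= nrm X. Proof. exact: sqrtr_ge0. Qed.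

Lemma nrm_sqr X : nrm X ^+ 2 = dot X X.
Proof. by rewrite sqr_sqrtr// dot_ge0. Qed.

Lemma normr_dot_le X Y : L2 X -> L2 Y -> `|dot X Y| <= nrm X * nrm Y.
Proof.
move=> lX lY; rewrite -(@ler_pXn2r _ 2)// ?nnegrE ?mulr_ge0 ?nrm_ge0//.
by rewrite exprMn !nrm_sqr real_normK ?num_real// Cauchy_Schwarz.
Qed.

Lemma nrm_dist X Y : L2 X -> L2 Y ->
  `|nrm X - nrm Y| <= nrm (fun w => X w - Y w).
Proof.
move=> lX lY; rewrite -(@ler_pXn2r _ 2)// ?nnegrE ?nrm_ge0//.
rewrite real_normK ?num_real// nrm_sqr dotB2// sqrrB !nrm_sqr.
have := le_trans (ler_norm _) (normr_dot_le lX lY).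
by rewrite -[_ *+ 2]mulr_natl; lra.
Qed.

Lemma Rintegral_abs_le_nrm X : L2 X -> \int[P]_w `|X w| <= nrm X.
Proof.
move=> lX.
have lA : L2 (fun w => `|X w|).
  have [mX iX] := lX; split; first exact: measurableT_comp.
  by under [X in EFin \o X]eq_fun do rewrite real_normK ?num_real//.
have := normr_dot_le lA (L2_cst 1).
have -> : dot (fun w => `|X w|) (cst 1) = \int[P]_w `|X w|.
  by apply: eq_Rintegral => w _; rewrite mulr1.
have -> : nrm (fun w => `|X w|) = nrm X.
  congr Num.sqrt; apply: eq_Rintegral => w _.
  by rewrite -expr2 real_normK ?num_real.
have -> : nrm (cst 1) = 1.
  rewrite /nrm (_ : dot _ _ = \int[P]_w 1); last first.
    by apply: eq_Rintegral => w _; rewrite mulr1.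
  have PT : fine (P setT) = 1 by rewrite probability_setT.
  by rewrite Rintegral_cst// PT mulr1 sqrtr1.
by rewrite mulr1; exact: le_trans (ler_norm _).
Qed.

Lemma dot_cvg X (Y : nat -> T -> R) Z : L2 X -> (forall n, L2 (Y n)) -> L2 Z ->
  dot (fun w => Z w - Y n w) (fun w => Z w - Y n w) @[n --> \oo] --> (0 : R) ->
  dot X (Y n) @[n --> \oo] --> dot X Z.
Proof.
move=> lX lY lZ ZY.
have h : nrm X * nrm (fun w => Z w - Y n w) @[n --> \oo] --> (0 : R).
  rewrite -(mulr0 (nrm X)); apply: cvgM; first exact: cvg_cst.
  rewrite -sqrtr0; apply: cvg_comp ZY _; exact: sqrt_continuous.
apply/subr_cvg0/norm_cvg0P.
apply: squeeze_cvgr _ (cvg_cst 0) h; apply: nearW => n.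
rewrite normr_ge0/= -normrN opprB dotC (dotC X) -dotBl// dotC normr_dot_le//.
exact: L2B.
Qed.

Section near_projection.
Context (I : eqType) (D : set I) (V : I -> T -> R).
Hypothesis lV : forall x, D x -> L2 (V x).

(** Combinations are lists of pairs (coefficient, index), repetitions allowed, so that adding two of
    them is concatenation. *)
Definition supported (s : seq (R * I)) := forall q, q \in s -> D q.2.

Definition lincomb (s : seq (R * I)) (w : T) := \sum_(q <- s) q.1 * V q.2 w.

Lemma L2_lincomb s : supported s -> L2 (lincomb s).
Proof.
rewrite /lincomb; elim: s => [|q s ih] sD.
  by under eq_fun do rewrite big_nil; exact: L2_cst.
under eq_fun do rewrite big_cons; apply: L2D.
  by apply/L2Z/lV/sD; rewrite mem_head.
by apply: ih => r rs; apply: sD; rewrite inE rs orbT.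
Qed.

Lemma Rintegral_lincomb s : supported s -> (forall x, D x -> \int[P]_w V x w = 0) ->
  \int[P]_w lincomb s w = 0.
Proof.
move=> + V0; elim: s => [|q s ih] sD.
  rewrite (_ : lincomb [::] = cst 0); last first.
    by apply/funext => w; rewrite /lincomb big_nil.
  by rewrite Rintegral_cst// mul0r.
have qD : D q.2 by apply: sD; rewrite mem_head.
have sD' : supported s by move=> r rs; apply: sD; rewrite inE rs orbT.
rewrite (_ : lincomb (q :: s) = fun w => q.1 * V q.2 w + lincomb s w); last first.
  by apply/funext => w; rewrite /lincomb big_cons.
rewrite RintegralD//; last 2 first.
- exact: L2_integrable (L2Z _ (lV qD)).
- exact: L2_integrable (L2_lincomb sD').
rewrite RintegralZl//; last exact: L2_integrable (lV qD).
by rewrite V0// mulr0 add0r ih.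
Qed.

(** Choose s whose squared distance to Y is within delta of the infimum. Moving the residual h by -
    t p' stays among the competitors, so delta - 2 t (h, p') + t^2 (p', p') >= 0 for all t, and the
    discriminant bounds (h, p'). The empty combination, with residual Y, gives the bound on the norm
    of h. *)
Lemma near_projection Y (delta : R) : 0 < delta -> L2 Y ->
  exists s, [/\ supported s,
    dot (fun w => Y w - lincomb s w) (fun w => Y w - lincomb s w) <= dot Y Y + delta &
    forall s', supported s' ->
      dot (fun w => Y w - lincomb s w) (lincomb s') ^+ 2 <=
      delta * dot (lincomb s') (lincomb s')].
Proof.
move=> delta0 lY; pose h s w := Y w - lincomb s w.
pose E := [set dot (h s) (h s) | s in supported].
have E0 : has_inf E.
  split; last by exists 0 => _ [s _ <-]; exact: dot_ge0.
  by exists (dot (h [::]) (h [::])), [::].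
have [_ [s sD <-] hs] := inf_adherent delta0 E0.
exists s; split=> //.
- rewrite (le_trans (ltW hs))// lerD2r.
  have -> : dot Y Y = dot (h [::]) (h [::]).
    by rewrite /dot/h; apply: eq_Rintegral => w _; rewrite /lincomb big_nil subr0.
  by apply: ge_inf; [exact: E0.2|exists [::]].
- move=> s' s'D; apply: discriminant_le => t.
  pose s2 := s ++ [seq (t * q.1, q.2) | q <- s'].
  have s2D : supported s2.
    by move=> q; rewrite mem_cat => /orP[/sD//|/mapP[r /s'D Dr ->]].
  have hs2 : h s2 = fun w => h s w - t * lincomb s' w.
    apply/funext => w; rewrite /h /lincomb big_cat/= big_map/= mulr_sumr opprD addrA.
    by congr (_ - _); apply: eq_bigr => q _; rewrite mulrA.
  have lh : L2 (h s) by apply: L2B => //; exact: L2_lincomb.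
  have l' := L2_lincomb s'D.
  have : inf E <= dot (h s2) (h s2) by apply: ge_inf; [exact: E0.2|exists s2].
  have lt := L2Z t l'.
  rewrite hs2 dotB2// dotZr// dotZl// dotZr// -/(h s) expr2 => hle.
  by move: (dot (h s) (h s)) (dot (h s) (lincomb s')) hs hle => a b hs hle; lra.
Qed.

End near_projection.

End L2_space.

(** * The cube: measurability, finite volume, compactness *)

Section cube.
Context (R : realType).

Lemma cube_cons n (D x : R) (t : n.-tuple R) :
  cube D (tuple_cons (x, t)) <-> 0 <= x <= D /\ cube D t.
Proof.
split=> [h|[hx ht] i].
  split; first by have := h ord0; rewrite tnth0.
  by move=> i; have := h (lift ord0 i); rewrite (tnthS x t i).
have [->|[j ->]] : i = ord0 \/ exists j, i = lift ord0 j.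
  by case: (unliftP ord0 i) => [j ->|->]; [right; exists j|left].
- by rewrite tnth0.
- by rewrite (tnthS x t j).
Qed.

Lemma measurable_cube n (D : R) : measurable (@cube R n D).
Proof.
rewrite (_ : cube D = \bigcap_(i in [set: 'I_n]) ((@tnth n R)^~ i @^-1` `[0, D])).
  apply: fin_bigcap_measurable => // i _.
  by rewrite -[X in measurable X]setTI; apply: measurable_tnth.
by apply/seteqP; split=> t /= h i; have := h i; rewrite /= in_itv/=; [move=> h' _|exact].
Qed.

Lemma tuple_lebesgue_cube_lty n (D : R) :
  (tuple_lebesgue n (@cube R n D) < +oo)%E.
Proof.
elim: n => [|n ih] /=.
  by rewrite diracE; case: (_ \in _); rewrite ltry.
rewrite /lebesgue_cons /pushforward.
rewrite (_ : _ @^-1` _ = (`[0, D] : set R) `*` @cube R n D); last first.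
  by apply/seteqP; split=> -[x t] /=; rewrite in_itv/= cube_cons.
rewrite product_measure1E//; last exact: measurable_cube.
have fin : lebesgue_measure (`[0, D] : set R) \is a fin_num.
  by rewrite lebesgue_measure_itv; case: ifP.
by rewrite lte_mul_pinfty.
Qed.

(* Local boundedness propagates to the whole cube by compactness, transported
   from row vectors. *)
Lemma cube_bounded n (D : R) (f : n.-tuple R -> R) :
  (forall x, cube D x -> exists2 delta, 0 < delta &
     forall y, cube D y -> (forall i, `|tnth y i - tnth x i| < delta) ->
       f y <= f x + 1) ->
  exists C, forall x, cube D x -> f x <= C.
Proof.
move=> hf; pose tup (v : 'rV[R]_n) : n.-tuple R := [tuple v ord0 i | i < n].
pose K := [set v : 'rV[R]_n | forall i, `[0, D]%classic (v ord0 i)].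
have cK : compact K.
  by apply: (@rV_compact _ _ (fun=> `[0, D]%classic)) => i; exact: segment_compact.
have KD v : K v -> cube D (tup v).
  by move=> Kv i; rewrite tnth_mktuple; have := Kv i; rewrite /= in_itv.
have cov := (near_covering_withinP K).2 ((compact_near_coveringP K).1 cK).
(* Compactness in near-covering form, the parameter C tending to +oo: a bound valid for large C near
   each point is valid for large C on all of [K]. *)
have [v Kv|] := cov R (pinfty_nbhs R) (fun C v => f (tup v) <= C) _.
  have [delta d0 hdelta] := hf _ (KD _ Kv).
  exists (ball v delta, [set C | f (tup v) + 1 < C]) => /=.
    by split; [exact: nbhsx_ballx|rewrite /=; apply: (nbhs_pinfty_gt (num_real _))].
  move=> [u C] /= [vu fC] Ku; rewrite (le_trans (hdelta (tup u) (KD _ Ku) _)) ?ltW//.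
  move=> i; rewrite !tnth_mktuple distrC.
  by have [_ /(_ ord0 i)] := vu.
move=> C [_ hC]; exists (C + 1) => x Dx.
have C1 : C < C + 1 by rewrite ltrDl.
have -> : x = tup (\row_i tnth x i).
  by apply: eq_from_tnth => i; rewrite tnth_mktuple mxE.
apply: (hC _ C1 (\row_i tnth x i)) => i.
by rewrite /= in_itv/= mxE.
Qed.

End cube.

(** * Random variables with a possibly degenerate normal law *)

Section normal_law.
Context d (T : measurableType d) (R : realType) (P : probability T R).
Local Notation N01 := (@normal_prob R 0 1).

Definition normal_law (m s : R) (X : T -> R) := forall B : set R, measurable B ->
  P (X @^-1` B) = N01 (affine m s @^-1` B).

Lemma gaussian_varP X : gaussian_var P X -> exists m s, 0 <= s /\ normal_law m s X.
Proof.
move=> [m [s h]]; exists m, `|s|; split=> // B mB; rewrite h//.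
have [->|s0] := eqVneq s 0; last exact: normal_probE.
rewrite normr0 (_ : affine m 0 = cst m); last first.
  by apply/funext => z; rewrite /affine mul0r addr0.
rewrite preimage_cst diracE; case: ifPn => mB'.
  by rewrite probability_setT.
by rewrite measure0.
Qed.

Lemma normal_law_ge0_integral m s X (g : R -> R) : normal_law m s X ->
  measurable_fun setT X -> measurable_fun setT g -> (forall x, 0 <= g x) ->
  (\int[P]_w (g (X w))%:E = \int[N01]_z (g (affine m s z))%:E)%E.
Proof.
move=> lX mX mg g0.
have maff : measurable_fun [set: measurableTypeR R] (affine m s : _ -> R).
  exact: measurable_affine.
have mgE : measurable_fun setT (EFin \o g) by exact/measurable_EFinP.
have g0E : {in [set: R], forall y, 0 <= (EFin \o g) y}%E.
  by move=> y _; rewrite lee_fin.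
have e1 := @ge0_integral_pushforward _ _ _ _ R _ mX P setT _ measurableT mgE g0E.
have e2 := @ge0_integral_pushforward _ _ _ _ R _ maff N01 setT _ measurableT mgE g0E.
rewrite !preimage_setT in e1 e2; apply: (etrans (esym e1) (etrans _ e2)).
by apply: eq_measure_integral => B mB _; exact: lX.
Qed.

Lemma normal_law_integral m s X (g : R -> R) : normal_law m s X ->
  measurable_fun setT X -> measurable_fun setT g ->
  N01.-integrable setT (fun z => (g (affine m s z))%:E) ->
  P.-integrable setT (fun w => (g (X w))%:E) /\
  \int[P]_w g (X w) = \int[N01]_z g (affine m s z).
Proof.
move=> lX mX mg ig.
have maff : measurable_fun [set: measurableTypeR R] (affine m s : _ -> R).
  exact: measurable_affine.
have mgE : measurable_fun setT (EFin \o g) by exact/measurable_EFinP.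
have igX : P.-integrable setT (fun w => (g (X w))%:E).
  apply/integrableP; split; first exact: measurableT_comp mgE mX.
  rewrite (normal_law_ge0_integral (g := fun x => `|g x|) lX mX)//; last first.
    exact: measurableT_comp.
  by have /integrableP[_] := ig.
split=> //; apply: (congr1 fine).
have e1 := @integral_pushforward _ _ _ _ R _ mX P setT _ mgE.
have e2 := @integral_pushforward _ _ _ _ R _ maff N01 setT _ mgE.
rewrite !preimage_setT in e1 e2.
apply: (etrans (esym (e1 igX measurableT)) (etrans _ (e2 ig measurableT))).
by apply: eq_measure_integral => B mB _; exact: lX.
Qed.

Lemma normal_law_L2 m s X : normal_law m s X -> measurable_fun setT X -> L2 P X.
Proof.
move=> lX mX; split=> //.
have [] := @normal_law_integral m s X (fun x => x ^+ 2) lX mX.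
- by apply: measurable_funX; exact: measurable_id.
- rewrite (_ : (fun z => _) = (fun z => (m ^+ 2)%:E +
    ((2 * m * s)%:E * z%:E + (s ^+ 2)%:E * (z ^+ 2)%:E)))%E; last first.
    by apply/funext => z; rewrite -!EFinM -!EFinD /affine; congr EFin; ring.
  apply: integrableD => //.
    apply: (@bounded_integrable_probability _ _ _ N01 setT (cst (m ^+ 2)) (m ^+ 2)) => //.
    by move=> z _; rewrite /= ger0_norm// sqr_ge0.
  apply: integrableD => //; apply: integrableZl => //.
  + exact: std_normal_integrable_id.
  + exact: std_normal_integrable_sqr.
- by [].
Qed.

Lemma normal_law_mean m s X : normal_law m s X -> measurable_fun setT X ->
  \int[P]_w X w = m.
Proof.
move=> lX mX.
have im : N01.-integrable setT (EFin \o cst m).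
  by apply: (@bounded_integrable_probability _ _ _ N01 setT (cst m) `|m|).
have iz : N01.-integrable setT (EFin \o (fun z : R => s * z)).
  rewrite (_ : _ \o _ = (fun z => s%:E * z%:E))%E//.
  by apply: integrableZl => //; exact: std_normal_integrable_id.
have [] := @normal_law_integral m s X idfun lX mX.
- exact: measurable_id.
- rewrite (_ : (fun z => _) = (fun z => m%:E + (s * z)%R%:E)%E)//.
  exact: integrableD.
move=> _ ->; rewrite /affine /= RintegralD// RintegralZl//; last first.
  exact: std_normal_integrable_id.
rewrite std_normal_mean mulr0 addr0 Rintegral_cst//.
have -> : fine (N01 setT) = 1 by rewrite probability_setT.
by rewrite mulr1.
Qed.

Lemma normal_law_second_moment m s X : normal_law m s X -> measurable_fun setT X ->
  dot P X X = m ^+ 2 + s ^+ 2.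
Proof.
move=> lX mX; have l2X := normal_law_L2 lX mX.
have l2c := L2_cst P m.
have mean := normal_law_mean lX mX.
suff : dot P (fun w => X w - cst m w) (fun w => X w - cst m w) = s ^+ 2.
  rewrite dotB2// => h.
  have Xm : dot P X (cst m) = m ^+ 2.
    by rewrite dotC /dot RintegralZl ?mean//; exact: L2_integrable.
  have mm : dot P (cst m) (cst m) = m ^+ 2.
    rewrite /dot -[LHS]/(\int[P]_w (m * m)) Rintegral_cst//.
    have -> : fine (P setT) = 1 by rewrite probability_setT.
    by rewrite mulr1.
  by move: h; rewrite Xm mm => <-; ring.
apply: (@congr1 _ _ fine _ (s ^+ 2)%:E).
under eq_integral do rewrite -expr2.
rewrite (normal_law_ge0_integral (g := fun x => (x - m) ^+ 2) lX mX); first last.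
- by move=> x; exact: sqr_ge0.
- by apply: measurable_funX; exact: measurable_funB.
under eq_integral do rewrite /affine addrC addKr exprMn EFinM.
rewrite integralZl//; last exact: std_normal_integrable_sqr.
by rewrite std_normal_second_moment mule1.
Qed.

(** Independence on rectangles identifies the joint law with the product law; by Fubini the inner
    integral at x is x E Y = 0. *)
Lemma indep_dot0 (X Y : {RV P >-> R}) : L2 P X -> L2 P Y -> \int[P]_w Y w = 0 ->
  (forall B C, measurable B -> measurable C ->
    P (X @^-1` B `&` Y @^-1` C) = (P (X @^-1` B) * P (Y @^-1` C))%E) ->
  dot P X Y = 0.
Proof.
move=> lX lY EY0 XY.
pose phi w := (X w, Y w).
have mphi : measurable_fun setT phi by exact: measurable_fun_pair.
pose joint := measure_function_pushforward__canonical__measure_function_Measure P mphi.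
pose f (z : R * R) := (z.1 * z.2)%:E.
have mf : measurable_fun setT f.
  by apply/measurable_EFinP; exact: measurable_funM.
have ifphi : P.-integrable (phi @^-1` setT) (f \o phi).
  by rewrite preimage_setT; exact: L2_mul.
have prodE : forall S, measurable S ->
    (distribution P X \x distribution P Y)%E S = joint S.
  by apply: product_measure_unique => B C mB mC; rewrite /joint/= -XY.
have ifprod : (distribution P X \x distribution P Y)%E.-integrable setT f.
  have /integrableP[_ ifj] := integrable_pushforward mphi mf ifphi measurableT.
  apply/integrableP; split=> //.
  rewrite (eq_measure_integral joint)// => S mS _; exact: prodE.
have iY : P.-integrable setT (EFin \o Y) by exact: L2_integrable.
have := integral_pushforward mphi mf ifphi measurableT.
rewrite preimage_setT => /(congr1 fine); rewrite -[X in _ = X]/(dot P X Y) => <-.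
rewrite -(eq_measure_integral joint (fun S mS _ => prodE S mS)).
rewrite -integral12_prod_meas1//.
rewrite (eq_integral (cst 0%E)) ?integral0// => x _; rewrite /fubini_F.
have ixY : P.-integrable setT (fun w => x%:E * (Y w)%:E)%E by exact: integrableZl.
rewrite (@integral_distribution _ _ _ _ _ P Y (fun y => f (x, y))).
- rewrite [LHS](_ : _ = \int[P]_w (x%:E * (Y w)%:E))%E//.
  rewrite integralZl// -[X in (_ * X)%E]fineK; last exact: integrable_fin_num.
  by rewrite -[fine _]/(\int[P]_w Y w) EY0 mule0.
- exact: (measurableT_comp mf (measurable_pair1 x)).
- exact: ixY.
Qed.

End normal_law.

(** * The truncated expansion lies in the closed span of the centered field *)

Section karhunen_loeve.
Context disp (T : measurableType disp) (R : realType) (P : probability T R).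
Context (n : nat) (D : R) (W : n.-tuple R -> {RV P >-> R}) (mu : n.-tuple R -> R).
Context (lam : nat -> R) (e : nat -> n.-tuple R -> R) (Z : nat -> {RV P >-> R}).
Hypothesis Z_iid : iid_standard_normal Z.

Let Z_law i : normal_law P 0 1 (Z i).
Proof.
move=> B mB; rewrite [LHS](proj2 Z_iid i B mB).
by rewrite normal_probE ?oner_neq0// normr1.
Qed.

Lemma iid_L2 i : L2 P (Z i).
Proof. exact: normal_law_L2 (@Z_law i) _. Qed.

Lemma iid_mean i : \int[P]_w Z i w = 0.
Proof. exact: normal_law_mean (@Z_law i) _. Qed.

Lemma iid_dot i j : dot P (Z i) (Z j) = (i == j)%:R.
Proof.
have [<-|ij] := eqVneq i j.
  by rewrite (normal_law_second_moment (@Z_law i))// expr0n expr1n add0r.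
apply: indep_dot0; [exact: iid_L2|exact: iid_L2|exact: iid_mean|].
(* Mutual independence is used on the two-element family i, j; the sets attached to other indices
   never enter the product. *)
move=> B C mB mC; have [/(_ [:: i; j] (fun k => if k == i then B else C))] := Z_iid.
rewrite /= inE ij => /(_ isT) h _.
have /h : forall k, measurable (if k == i then B else C) by move=> k; case: ifP.
rewrite !big_cons big_nil eqxx (negbTE (_ : j != i)) 1?eq_sym// mule1 => <-.
congr (P _); apply/seteqP; split=> w /=.
  move=> [Bi Cj] k /=; rewrite !inE => /orP[/eqP ->|/eqP ->]; rewrite ?eqxx//.
  by rewrite eq_sym (negbTE ij).
move=> h'; split.
  by have := h' i; rewrite /= !inE eqxx; exact.
by have := h' j; rewrite /= !inE eqxx orbT eq_sym (negbTE ij); exact.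
Qed.

Definition KL_centered (M : nat) (x : n.-tuple R) (w : T) : R :=
  \sum_(i < M) Num.sqrt (lam i) * Z i w * e i x.

Let KL_centeredE M x :
  KL_centered M x = fun w => \sum_(i < M) (Num.sqrt (lam i) * e i x) * Z i w.
Proof.
by apply/funext => w; apply: eq_bigr => i _; rewrite mulrAC.
Qed.

Lemma KL_centered_L2 M x : L2 P (KL_centered M x).
Proof.
by rewrite KL_centeredE; apply: L2_sum => i; apply: L2Z; exact: iid_L2.
Qed.

Lemma dot_KL_centered M x Y : L2 P Y ->
  dot P (KL_centered M x) Y =
  \sum_(i < M) Num.sqrt (lam i) * e i x * dot P (Z i) Y.
Proof.
move=> lY; rewrite KL_centeredE dot_suml//; last first.
  by move=> i; apply: L2Z; exact: iid_L2.
by apply: eq_bigr => i _; rewrite dotZl//; exact: iid_L2.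
Qed.

Lemma KL_centered_mean M x : \int[P]_w KL_centered M x w = 0.
Proof.
have := dot_KL_centered M x (L2_cst P 1).
rewrite [LHS](_ : _ = \int[P]_w KL_centered M x w); last first.
  by apply: eq_Rintegral => w _; rewrite mulr1.
move=> ->; rewrite big1// => i _.
have -> : dot P (Z i) (cst 1) = 0.
  by rewrite -(iid_mean i); apply: eq_Rintegral => w _; rewrite mulr1.
by rewrite mulr0.
Qed.

Hypothesis lam_ge0 : forall i, 0 <= lam i.

Lemma KL_centered_second_moment M x :
  dot P (KL_centered M x) (KL_centered M x) = \sum_(i < M) lam i * e i x ^+ 2.
Proof.
rewrite dot_KL_centered; last exact: KL_centered_L2.
apply: eq_bigr => i _; rewrite dotC dot_KL_centered; last exact: iid_L2.
rewrite (bigD1 i)//= iid_dot eqxx mulr1 big1 ?addr0; last first.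
  by move=> j ji; rewrite iid_dot -val_eqE/= in ji *; rewrite (negbTE ji) mulr0.
by rewrite -expr2 exprMn sqr_sqrtr.
Qed.

Hypothesis W_mean : forall x, cube D x -> 'E_P[W x]%E = (mu x)%:E.
Hypothesis W_KL : KL_expansion (cube D) mu lam Z e W.

Definition centered (x : n.-tuple R) (w : T) : R := W x w - mu x.

Let KL_error M x : (fun w => (W x w - KL_sum mu lam Z e M x w) ^+ 2) =
  (fun w => (centered x w - KL_centered M x w) ^+ 2).
Proof. by apply/funext => w; rewrite /KL_sum opprD addrA. Qed.

(** An extended-real sequence tending to 0 is eventually finite, so some truncation error is square
    integrable; adding back the truncation gives the claim. *)
Lemma centered_L2 x : cube D x -> L2 P (centered x).
Proof.
move=> Dx; have [M /=] : exists M, ('E_P[fun w =>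
    ((W x w - KL_sum mu lam Z e M x w) ^+ 2)%R]%E \is a fin_num).
  have /fine_cvgP[[M _ finM] _] := W_KL Dx.
  by exists M; apply: finM => /=.
rewrite KL_error unlock => finM.
have mc : measurable_fun setT (centered x) by exact: measurable_funB.
have [mK _] := KL_centered_L2 M x.
have : L2 P (fun w => (centered x w - KL_centered M x w) + KL_centered M x w).
  apply: L2D; last exact: KL_centered_L2.
  split; first exact: measurable_funB.
  apply/integrableP; split.
    by apply/measurable_EFinP/measurable_funX; exact: measurable_funB.
  under eq_integral do rewrite /= ger0_norm ?sqr_ge0//.
  rewrite -ge0_fin_numE//; apply: integral_ge0 => w _.
  by rewrite lee_fin sqr_ge0.
by under eq_fun do rewrite subrK.
Qed.

Lemma centered_cvg x : cube D x ->
  dot P (fun w => centered x w - KL_centered M x w)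
    (fun w => centered x w - KL_centered M x w) @[M --> \oo] --> (0 : R).
Proof.
move=> Dx; apply: cvg_trans (fine_cvg (W_KL Dx)).
apply: near_eq_cvg; apply: nearW => M.
rewrite /= KL_error unlock; apply: (congr1 fine).
by apply: eq_integral => w _; rewrite expr2.
Qed.

Lemma RV_L2 x : cube D x -> L2 P (W x).
Proof.
move=> Dx; have := L2D (centered_L2 Dx) (L2_cst P (mu x)).
by under eq_fun do rewrite subrK.
Qed.

Lemma RV_mean x : cube D x -> \int[P]_w W x w = mu x.
Proof.
by move=> Dx; have := W_mean Dx; rewrite unlock => /(congr1 fine).
Qed.

Lemma centered_mean x : cube D x -> \int[P]_w centered x w = 0.
Proof.
move=> Dx; rewrite /centered RintegralB//; last 2 first.
- exact/L2_integrable/RV_L2.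
- exact/L2_integrable/L2_cst.
rewrite RV_mean// Rintegral_cst//.
have -> : fine (P setT) = 1 by rewrite probability_setT.
by rewrite mulr1 subrr.
Qed.

(** The norms of the truncations increase with M, being roots of partial sums of lam_i e_i(x)^2, and
    converge to the norm of the full centered variable. This makes the domination in
    [KL_coefficient_le] uniform in M. *)
Lemma nrm_KL_centered_le M x : cube D x ->
  nrm P (KL_centered M x) <= nrm P (centered x).
Proof.
move=> Dx.
have nd : {homo (fun M => nrm P (KL_centered M x)) : a b / (a <= b)%N >-> a <= b}.
  move=> a b ab; rewrite ler_sqrt ?dot_ge0// !KL_centered_second_moment.
  rewrite -!(big_mkord xpredT (fun i => lam i * e i x ^+ 2)).
  rewrite (big_cat_nat (leq0n a) ab)//= lerDl sumr_ge0// => i _.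
  by rewrite mulr_ge0// sqr_ge0.
have cv : nrm P (KL_centered M x) @[M --> \oo] --> nrm P (centered x).
  apply/subr_cvg0/norm_cvg0P.
  have h : nrm P (fun w => centered x w - KL_centered M x w) @[M --> \oo] --> (0 : R).
    by rewrite -sqrtr0; apply: cvg_comp (centered_cvg Dx) _; exact: sqrt_continuous.
  apply: squeeze_cvgr _ (cvg_cst 0) h; apply: nearW => k.
  rewrite normr_ge0/= -normrN opprB nrm_dist//; first exact: centered_L2.
  exact: KL_centered_L2.
have := nondecreasing_cvgn_le nd.
move=> /(_ (cvgP _ cv) M); rewrite (cvg_lim _ cv)//.
Qed.

Hypothesis W_gauss : gaussian_field (cube D) W.

(** Mean-square continuity keeps the variation of the norm of [W x] below 1 locally, compactness
    makes a global bound of it, and subtracting the mean can only decrease the norm. *)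
Lemma centered_bounded : exists2 C, 0 <= C &
  forall x, cube D x -> nrm P (centered x) <= C.
Proof.
have [C hC] : exists C, forall x, cube D x -> nrm P (W x) <= C.
  apply: cube_bounded => x Dx; have [_ cont _] := W_gauss.
  have [delta d0 hd] := cont x Dx 1 ltr01.
  exists delta => // y Dy /(hd y Dy) yx.
  have lxy : L2 P (fun w => W y w - W x w) by apply: L2B; exact: RV_L2.
  have : nrm P (fun w => W y w - W x w) <= 1.
    rewrite -[leRHS]sqrtr1 ler_sqrt// -lee_fin; apply: le_trans (ltW yx).
    rewrite unlock /dot /Rintegral fineK; last first.
      by apply: integrable_fin_num => //; exact: L2_mul.
    by under [leRHS]eq_integral do rewrite expr2.
  have := nrm_dist (RV_L2 Dy) (RV_L2 Dx); rewrite ler_norml => /andP[_].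
  lra.
(* The absolute value covers an empty cube, for which C may be negative. *)
exists `|C| => // x Dx.
rewrite (le_trans _ (ler_norm C))// (le_trans _ (hC x Dx))//.
rewrite ler_sqrt ?dot_ge0// /centered dotB2//; last 2 first.
- exact: RV_L2.
- exact: L2_cst.
have -> : dot P (W x) (fun=> mu x) = mu x ^+ 2.
  by rewrite dotC /dot RintegralZl ?RV_mean//; exact/L2_integrable/RV_L2.
have -> : dot P (fun=> mu x) (fun=> mu x) = mu x ^+ 2.
  rewrite /dot Rintegral_cst//.
  have -> : fine (P setT) = 1 by rewrite probability_setT.
  by rewrite mulr1.
by have := sqr_ge0 (mu x); lra.
Qed.

Hypothesis e_basis : orthonormal_basis (cube D) e.

Let tl := tuple_lebesgue n : {measure set (n.-tuple R) -> \bar R}.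

Let basis_measurable j : measurable_fun (cube D) (e j).
Proof. by have [/(_ j)[]] := e_basis. Qed.

Let basis_integrable_sqr j : tl.-integrable (cube D) (EFin \o (fun x => e j x ^+ 2)).
Proof.
have [/(_ j)[mej ej] _ _] := e_basis; apply/integrableP; split.
  by apply/measurable_EFinP; exact: measurable_funX.
by under eq_integral do rewrite /= ger0_norm ?sqr_ge0//.
Qed.

Let basis_integrable_mul i j : tl.-integrable (cube D) (EFin \o (fun x => e i x * e j x)).
Proof.
have mD := @measurable_cube R n D.
apply: (le_integrable mD _ _
  (integrableD mD (basis_integrable_sqr i) (basis_integrable_sqr j))).
  by apply/measurable_EFinP; exact: measurable_funM.
move=> x _; rewrite /= lee_fin [leRHS]ger0_norm; last by rewrite addr_ge0// sqr_ge0.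
have := sqr_ge0 (e i x - e j x); have := sqr_ge0 (e i x + e j x).
by rewrite !expr2 ler_norml => h1 h2; apply/andP; split; nra.
Qed.

Let basis_integrable_norm j : tl.-integrable (cube D) (EFin \o (fun x => `|e j x|)).
Proof.
have mD := @measurable_cube R n D.
have i1 : tl.-integrable (cube D) (EFin \o cst 1).
  apply: (@bounded_integrable _ _ _ tl (cube D) (cst 1) 1) => //.
    exact: tuple_lebesgue_cube_lty.
  by move=> x _; rewrite /= normr1.
apply: (le_integrable mD _ _ (integrableD mD i1 (basis_integrable_sqr j))).
  by apply/measurable_EFinP; exact: measurableT_comp.
move=> x _; rewrite /= lee_fin normr_id [leRHS]ger0_norm; last first.
  by rewrite addr_ge0// sqr_ge0.
have := sqr_ge0 (`|e j x| - 1); rewrite sqrrB1 real_normK ?num_real// => h.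
have := normr_ge0 (e j x); lra.
Qed.

(** Integrating x |-> E (V(x) h) against e_j extracts the j-th coefficient by orthonormality. Series
    and integral are exchanged by dominated convergence, the truncations being dominated by a
    constant multiple of |e_j|, which is integrable because the cube has finite volume. *)
Lemma KL_coefficient_le h j (rho : R) : L2 P h ->
  (forall x, cube D x -> `|dot P (centered x) h| <= rho) ->
  `|Num.sqrt (lam j) * dot P (Z j) h| <= rho * \int[tl]_(x in cube D) `|e j x|.
Proof.
move=> lh hrho; have mD := @measurable_cube R n D.
have [C C0 hC] := centered_bounded.
pose S M x := dot P (KL_centered M x) h.
have SE M x : S M x * e j x =
    \sum_(i < M) (Num.sqrt (lam i) * dot P (Z i) h) * (e i x * e j x).
  rewrite /S dot_KL_centered// mulr_suml; apply: eq_bigr => i _; ring.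
have iSE M (i : 'I_M) : tl.-integrable (cube D) (EFin \o
    (fun x => (Num.sqrt (lam i) * dot P (Z i) h) * (e i x * e j x))).
  rewrite (_ : _ \o _ = (fun x => (Num.sqrt (lam i) * dot P (Z i) h)%R%:E *
    (e i x * e j x)%R%:E)%E); last by apply/funext => x; rewrite /= EFinM.
  exact: (integrableZl mD _ (basis_integrable_mul i j)).
have [|x Dx|||if_ cvgS] := @Rintegral_dominated_cvg _ _ _ tl (cube D)
    (fun M x => S M x * e j x) (fun x => dot P (centered x) h * e j x)
    (fun x => (C * nrm P h) * `|e j x|) mD.
- move=> M; under eq_fun do rewrite SE.
  have [/(measurable_int tl)/measurable_EFinP iS _] :=
    Rintegral_sum (index_enum 'I_M) mD (iSE M).
  exact: iS.
- apply: cvgM; last exact: cvg_cst.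
  under eq_fun do rewrite /S dotC; rewrite dotC.
  apply: dot_cvg => //; [|exact: centered_L2|exact: centered_cvg].
  by move=> M; exact: KL_centered_L2.
- rewrite (_ : _ \o _ = (fun x => (C * nrm P h)%R%:E * (`|e j x|)%R%:E)%E); last first.
    by apply/funext => x; rewrite /= EFinM.
  exact: (integrableZl mD _ (basis_integrable_norm j)).
- move=> M x Dx; rewrite normrM ler_wpM2r//.
  rewrite (le_trans (normr_dot_le (KL_centered_L2 M x) lh))//.
  rewrite ler_wpM2r ?nrm_ge0//.
  by rewrite (le_trans (nrm_KL_centered_le M Dx))// hC.
have limE : \int[tl]_(x in cube D) (dot P (centered x) h * e j x) =
    Num.sqrt (lam j) * dot P (Z j) h.
  (* As soon as M > j the integral of the truncation equals the j-th coefficient exactly. *)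
  rewrite -(cvg_lim _ cvgS)//; apply: cvg_lim => //; apply: cvg_near_cst.
  exists j.+1 => // M /= jM.
  under eq_Rintegral do rewrite SE.
  have [_ ->] := Rintegral_sum (index_enum 'I_M) mD (iSE M).
  rewrite (bigD1 (Ordinal jM))//= big1 ?addr0.
    rewrite RintegralZl//.
    have [_ /(_ j j) ejj _] := e_basis.
    by rewrite -[X in _ * X]/(L2_inner (cube D) (e j) (e j)) ejj eqxx mulr1.
  move=> i ij; rewrite RintegralZl//.
  have [_ /(_ i j) eij _] := e_basis.
  rewrite -[X in _ * X]/(L2_inner (cube D) (e i) (e j)) eij.
  by rewrite -val_eqE/= in ij; rewrite (negbTE ij) mulr0.
rewrite -limE (le_trans (le_normr_Rintegral mD if_))//.
rewrite -RintegralZl//; apply: le_Rintegral => //.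
- by move/integrable_norm : if_.
- rewrite (_ : _ \o _ = (fun x => rho%:E * (`|e j x|)%R%:E)%E); last first.
    by apply/funext => x; rewrite /= EFinM.
  exact: (integrableZl mD _ (basis_integrable_norm j)).
- by move=> x Dx; rewrite normrM ler_wpM2r// hrho.
Qed.

(* A near-minimizer [p] of the distance from the truncated expansion to the span
   of the field leaves a residual almost orthogonal to every [centered x], hence,
   by [KL_coefficient_le], to every mode of the expansion. *)
Lemma KL_centered_span N x0 (eta : R) : cube D x0 -> 0 < eta ->
  exists2 s, supported (cube D) s &
    nrm P (fun w => KL_centered N x0 w - lincomb centered s w) <= eta.
Proof.
move=> Dx0 eta0; have [C C0 hC] := centered_bounded.
pose Y := KL_centered N x0; have lY : L2 P Y by exact: KL_centered_L2.
(* If every (V(x), h) is at most r C in absolute value, summing the coefficient bounds over the N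
   modes at x0 gives (h, Y) <= r C A. *)
pose A := \sum_(j < N) `|e j x0| * \int[tl]_(x in cube D) `|e j x|.
have A0 : 0 <= A.
  by apply: sumr_ge0 => j _; rewrite mulr_ge0// Rintegral_ge0.
(* With p the near-projection, (h, h) = (h, Y) - (h, p) <= r C A + r nrm p, and nrm p <= 2 nrm Y +
   1, so (h, h) <= r K. *)
pose K := C * A + 2 * nrm P Y + 1.
have K0 : 0 < K by rewrite ltr_wpDl// addr_ge0 ?mulr_ge0// nrm_ge0.
(* The slack will be r^2, so inner products with the span carry the factor r. The bound r <= 1 keeps
   nrm h below nrm Y + 1; the other one gives r K <= eta^2. *)
pose r := Num.min 1 (eta ^+ 2 / K).
have r0 : 0 < r by rewrite lt_min ltr01 divr_gt0// exprn_gt0.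
have r1 : r <= 1 by rewrite ge_min lexx.
have rK : r * K <= eta ^+ 2 by rewrite -ler_pdivlMr// ge_min lexx orbT.
have [s [sD hle hs]] := near_projection centered_L2 (exprn_gt0 2 r0) lY.
exists s => //; set h := (fun w => _) in hle hs *.
have lp : L2 P (lincomb centered s) by exact: L2_lincomb centered_L2 _ sD.
have lh : L2 P h by exact: L2B.
have dot_small s' : supported (cube D) s' ->
    `|dot P h (lincomb centered s')| <= r * nrm P (lincomb centered s').
  move=> s'D; rewrite -(@ler_pXn2r _ 2)// ?nnegrE ?mulr_ge0 ?nrm_ge0 ?(ltW r0)//.
  by rewrite real_normK ?num_real// exprMn nrm_sqr hs.
have hcent x : cube D x -> `|dot P (centered x) h| <= r * C.
  move=> Dx; have s1D : supported (cube D) [:: (1 : R, x)].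
    by move=> q; rewrite inE => /eqP ->.
  have := dot_small _ s1D.
  have -> : lincomb centered [:: (1 : R, x)] = centered x.
    by apply/funext => w; rewrite /lincomb big_seq1 mul1r.
  move=> hx; rewrite dotC (le_trans hx)// ler_wpM2l ?(ltW r0)//.
  exact: hC.
have hY : dot P h Y <= r * (C * A).
  rewrite dotC dot_KL_centered// (le_trans (ler_norm _))//.
  rewrite (le_trans (ler_norm_sum _ _ _))// /A !mulr_sumr ler_sum// => j _.
  rewrite mulrAC normrM [in leRHS]mulrA [in leRHS]mulrCA mulrC ler_wpM2l//.
  exact: KL_coefficient_le.
have nh : nrm P h <= nrm P Y + 1.
  rewrite -(@ler_pXn2r _ 2)// ?nnegrE ?addr_ge0 ?nrm_ge0//.
  rewrite nrm_sqr (le_trans hle)// sqrrD1 nrm_sqr.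
  have := nrm_ge0 P Y; have : r ^+ 2 <= 1 by rewrite expr_le1// ltW.
  by rewrite -mulr_natl; lra.
have np : nrm P (lincomb centered s) <= 2 * nrm P Y + 1.
  have := nrm_dist lY lp; rewrite -/h ler_norml => /andP[h1 _].
  by lra.
have : dot P h h <= eta ^+ 2.
  apply: le_trans rK.
  have -> : dot P h h = dot P h Y - dot P h (lincomb centered s).
    by rewrite [in RHS]dotC [X in _ - X]dotC -dotBl// dotC.
  have := dot_small _ sD; rewrite ler_norml => /andP[h1 _].
  have := ler_wpM2l (ltW r0) np.
  by rewrite /K; lra.
by rewrite -nrm_sqr ler_pXn2r// nnegrE ?nrm_ge0// ltW.
Qed.

End karhunen_loeve.

(** * Functions measurable with respect to the field *)

Section sigma_generated_functions.
Context disp (T : measurableType disp) (R : realType).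
Context (I : eqType) (J : set I) (X : I -> T -> R).

Lemma sigma_generated_preimage i B : J i -> measurable B ->
  sigma_generated J X (X i @^-1` B).
Proof.
move=> Ji mB; apply: sub_sigma_algebra; exists i => //.
by exists B => //; rewrite setTI.
Qed.

(** [T] is equipped with the generated sigma-algebra itself, under which each [X i] is measurable,
    and the usual closure under sums and products applies. *)
Lemma sigma_generated_affine_lincomb (c a : R) (V : I -> R) s B : supported J s ->
  measurable B ->
  sigma_generated J X
    ((fun w => c + lincomb (fun x w => X x w - V x) s w) @^-1` B).
Proof.
move=> sJ mB.
pose G := \bigcup_(i in J) preimage_set_system setT (X i) measurable.
have mX i : J i -> measurable_fun [set: g_sigma_algebraType G] (X i).
  by move=> Ji _ Y mY; rewrite setTI; exact: sigma_generated_preimage.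
suff ml : measurable_fun [set: g_sigma_algebraType G]
    (fun w => c + lincomb (fun x w => X x w - V x) s w).
  by have := ml measurableT B mB; rewrite setTI.
apply: measurable_funD => //; rewrite /lincomb.
elim: s sJ => [|q s ih] sJ.
  by under eq_fun do rewrite big_nil; exact: measurable_cst.
under eq_fun do rewrite big_cons; apply: measurable_funD.
  apply: measurable_funM => //; apply: measurable_funB => //.
  by apply: mX; apply: sJ; rewrite mem_head.
by apply: ih => r rs; apply: sJ; rewrite inE rs orbT.
Qed.

End sigma_generated_functions.

(** * Gaussian law of the truncated expansion, jointly with an independent event *)

Section law_of_expansion.
Context disp (T : measurableType disp) (R : realType) (P : probability T R).
Local Notation N01 := (@normal_prob R 0 1).

Lemma normal_law_shift m s (X : T -> R) (c : R) : normal_law P m s X ->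
  normal_law P (c + m) s (fun w => c + X w).
Proof.
move=> lX B mB; have mc : measurable_fun setT (fun x : R => c + x).
  exact: measurable_funD.
have := lX _ (mc measurableT B mB); rewrite setTI => h.
rewrite [LHS](_ : _ = P (X @^-1` ((fun x => c + x) @^-1` B)))// h.
congr (N01 _); apply/seteqP; split=> z /=; rewrite /affine addrA; exact.
Qed.

Context (n : nat) (D : R) (W : n.-tuple R -> {RV P >-> R}) (mu : n.-tuple R -> R).
Context (lam : nat -> R) (e : nat -> n.-tuple R -> R) (Z : nat -> {RV P >-> R}).
Hypothesis Z_iid : iid_standard_normal Z.
Hypothesis lam_ge0 : forall i, 0 <= lam i.
Hypothesis W_mean : forall x, cube D x -> 'E_P[W x]%E = (mu x)%:E.
Hypothesis W_KL : KL_expansion (cube D) mu lam Z e W.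
Hypothesis W_gauss : gaussian_field (cube D) W.
Hypothesis e_basis : orthonormal_basis (cube D) e.

Let cL2 := centered_L2 Z_iid W_KL.

(** The Gaussian field provides a normal law with unknown parameters; they are read off from the
    mean, which is 0 after centering, and the second moment. *)
Lemma lincomb_normal_law (c : R) s : supported (cube D) s ->
  normal_law P c (nrm P (lincomb (centered W mu) s))
    (fun w => c + lincomb (centered W mu) s w).
Proof.
move=> sD; have lp := L2_lincomb cL2 sD; have [mp _] := lp.
pose a (i : 'I_(size s)) := (tnth (in_tuple s) i).1.
pose x (i : 'I_(size s)) := (tnth (in_tuple s) i).2.
have [gauss _ _] := W_gauss.
have xD i : cube D (x i) by apply: sD; exact: mem_tnth.
have [m [t [t0 lG]]] := gaussian_varP (gauss _ x a xD).
pose b := \sum_(i < size s) a i * mu (x i).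
have pE : lincomb (centered W mu) s =
    fun w => - b + \sum_(i < size s) a i * W (x i) w.
  apply/funext => w; rewrite /lincomb big_tnth /b addrC -sumrB.
  by apply: eq_bigr => i _; rewrite /centered mulrBr.
have lP := normal_law_shift (- b) lG.
rewrite -pE in lP.
have mean0 : \int[P]_w lincomb (centered W mu) s w = 0.
  apply: Rintegral_lincomb sD _ => // x' Dx'.
  exact: (centered_mean Z_iid W_mean W_KL).
have m0 : - b + m = 0 by rewrite -(normal_law_mean lP mp).
rewrite m0 in lP.
have -> : nrm P (lincomb (centered W mu) s) = t.
  by rewrite /nrm (normal_law_second_moment lP mp) expr0n add0r sqrtr_sqr ger0_norm.
by have := normal_law_shift c lP; rewrite addr0.
Qed.

Let abs_moment := \int[N01]_z `|z|.

Let abs_moment_integrable : N01.-integrable setT (EFin \o (fun z : R => `|z|)).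
Proof. by have /integrable_norm := std_normal_integrable_id R. Qed.

Variable A : set T.
Hypothesis mA : measurable A.
Hypothesis indepA : forall B, sigma_generated (cube D) (fun x => W x : T -> R) B ->
  P (A `&` B) = (P A * P B)%E.

(** Replace the truncation Y by a nearby p in the span. On the left this costs K E |Y - p| <= K eta;
    for p itself independence and normality are available; on the right the standard deviations
    differ by at most eta, which costs K eta E |z|. *)
Lemma KL_sum_lipschitz_law N x0 g : cube D x0 -> lipschitz_test g ->
  \int[P]_(w in A) g (KL_sum mu lam Z e N x0 w) =
  fine (P A) * \int[N01]_z g (affine (mu x0) (nrm P (KL_centered lam e Z N x0)) z).
Proof.
move=> Dx0 gt; have [g01 [K K0 gK]] := gt.
have mg := lipschitz_test_measurable gt.
set Y := KL_centered lam e Z N x0.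
have lY : L2 P Y by exact: KL_centered_L2.
have [mY _] := lY.
have gabs x : `|g x| <= 1 by have /andP[g0 g1] := g01 x; rewrite ger0_norm.
have PA1 : fine (P A) <= 1.
  by rewrite -lee_fin fineK ?fin_num_measure// probability_le1.
have PA0 : 0 <= fine (P A) by exact: fine_ge0.
have m1_ge0 : 0 <= abs_moment by exact: Rintegral_ge0.
have igX (X : T -> R) : measurable_fun setT X ->
    P.-integrable A (EFin \o (fun w => g (X w))).
  move=> mX; apply: (@bounded_integrable_probability _ _ _ P A _ 1) => //.
  exact: measurable_funTS (measurableT_comp mg mX).
have igN s : N01.-integrable setT (EFin \o (fun z => g (affine (mu x0) s z))).
  apply: (@bounded_integrable_probability _ _ _ N01 setT
    (fun z => g (affine (mu x0) s z)) 1) => //.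
  exact: measurableT_comp mg (measurable_affine _ _).
apply/eqP; rewrite -subr_eq0 -normr_le0; apply/ler_addgt0Pl => eps eps0.
rewrite addr0.
(* The two errors add up to eta K (1 + E |z|) <= eta M = eps; the final 1 keeps M positive when K =
   0. *)
pose M := K * (1 + abs_moment) + 1.
have M0 : 0 < M by rewrite ltr_wpDl// mulr_ge0// addr_ge0.
have [s sD hs] := KL_centered_span Z_iid lam_ge0 W_mean W_KL W_gauss e_basis N
  Dx0 (divr_gt0 eps0 M0).
set p := lincomb (centered W mu) s in hs.
have lp := L2_lincomb cL2 sD; rewrite -/p in lp.
have [mp _] := lp.
set eta := eps / M in hs.
have mcY : measurable_fun setT (fun w => mu x0 + Y w) by exact: measurable_funD.
have mcp : measurable_fun setT (fun w => mu x0 + p w) by exact: measurable_funD.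
have step1 : `|\int[P]_(w in A) g (mu x0 + Y w) - \int[P]_(w in A) g (mu x0 + p w)|
    <= K * eta.
  rewrite -RintegralB//; [|exact: igX|exact: igX].
  have lYp : L2 P (fun w => Y w - p w) by exact: L2B.
  have iYp : P.-integrable setT (EFin \o (fun w => `|Y w - p w|)).
    by have /integrable_norm := L2_integrable lYp.
  have iKYp : P.-integrable setT (EFin \o (fun w => K * `|Y w - p w|)).
    rewrite (_ : _ \o _ = (fun w => K%:E * (`|Y w - p w|)%R%:E)%E).
      exact: integrableZl.
    by apply/funext => w; rewrite /= EFinM.
  have igg : P.-integrable A (EFin \o (fun w => g (mu x0 + Y w) - g (mu x0 + p w))).
    rewrite (_ : _ \o _ =
      (fun w => (g (mu x0 + Y w))%:E - (g (mu x0 + p w))%:E)%E)//.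
    by apply: integrableB => //; exact: igX.
  rewrite (le_trans (le_normr_Rintegral mA igg))//.
  apply: (@le_trans _ _ (\int[P]_(w in A) (K * `|Y w - p w|))).
    apply: le_Rintegral => //.
    - by move/integrable_norm : igg.
    - exact: integrableS iKYp.
    - move=> w _; rewrite (le_trans (gK _ _))// ler_wpM2l//.
      by rewrite opprD addrACA subrr add0r.
  rewrite RintegralZl//; last exact: integrableS iYp.
  rewrite ler_wpM2l// (le_trans _ hs)//.
  rewrite (le_trans _ (Rintegral_abs_le_nrm lYp))//.
  rewrite /Rintegral fine_le//.
  - by apply: integrable_fin_num => //; exact: integrableS iYp.
  - exact: integrable_fin_num.
  - apply: ge0_subset_integral => //.
    by apply: (measurable_int P).
have step2 : \int[P]_(w in A) g (mu x0 + p w) =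
    fine (P A) * \int[P]_w g (mu x0 + p w).
  apply: indep_integral => // B mB; apply: indepA.
  exact: sigma_generated_affine_lincomb.
have lawp := lincomb_normal_law (mu x0) sD; rewrite -/p in lawp.
have step3 : \int[P]_w g (mu x0 + p w) =
    \int[N01]_z g (affine (mu x0) (nrm P p) z).
  by have [] := normal_law_integral lawp mcp mg (igN _).
have step4 : `|\int[N01]_z g (affine (mu x0) (nrm P p) z) -
    \int[N01]_z g (affine (mu x0) (nrm P Y) z)| <= K * eta * abs_moment.
  rewrite -RintegralB//.
  have igg : N01.-integrable setT (EFin \o (fun z =>
      g (affine (mu x0) (nrm P p) z) - g (affine (mu x0) (nrm P Y) z))).
    rewrite (_ : _ \o _ = (fun z => (g (affine (mu x0) (nrm P p) z))%:E -
       (g (affine (mu x0) (nrm P Y) z))%:E)%E)//.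
    by apply: integrableB => //; exact: igN.
  rewrite (le_trans (le_normr_Rintegral _ igg))//.
  rewrite -RintegralZl//.
  apply: le_Rintegral => //.
  - by move/integrable_norm : igg.
  - rewrite (_ : _ \o _ = (fun z => (K * eta)%R%:E * (`|z|)%R%:E)%E).
      exact: integrableZl.
    by apply/funext => z; rewrite /= EFinM.
  - move=> z _; rewrite (le_trans (gK _ _))// /affine -mulrA ler_wpM2l//.
    rewrite opprD addrACA subrr add0r -mulrBl normrM ler_wpM2r//.
    rewrite distrC (le_trans (nrm_dist lY lp))//.
have -> : \int[P]_(w in A) g (KL_sum mu lam Z e N x0 w) =
    \int[P]_(w in A) g (mu x0 + Y w) by [].
have etaM : eta * M = eps by rewrite divfK// gt_eqF.
have eta0 : 0 < eta by exact: divr_gt0.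
rewrite step2 step3 in step1.
move: step1 step4.
move: (\int[P]_(w in A) g _) (\int[N01]_z g (affine _ (nrm P p) z))
  (\int[N01]_z g (affine _ (nrm P Y) z)) => u v t h1 h4.
have -> : u - fine (P A) * t = (u - fine (P A) * v) + fine (P A) * (v - t) by ring.
rewrite (le_trans (ler_normD _ _))// normrM (ger0_norm PA0).
have : fine (P A) * `|v - t| <= K * eta * abs_moment.
  by rewrite (le_trans _ h4)// ler_piMl.
move=> h5; rewrite (le_trans (lerD h1 h5))//.
by rewrite -etaM /M; nra.
Qed.

(** Both sides are finite measures in B, the image of P restricted to A and a multiple of a normal
    law, and they agree on Lipschitz test functions. *)
Lemma KL_sum_law N x0 B : cube D x0 -> measurable B ->
  P (A `&` KL_sum mu lam Z e N x0 @^-1` B) =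
  (P A * N01 (affine (mu x0) (nrm P (KL_centered lam e Z N x0)) @^-1` B))%E.
Proof.
move=> Dx0 mB; set sigma := nrm _ _.
have mX : measurable_fun setT (KL_sum mu lam Z e N x0).
  apply: measurable_funD => //.
  by have [] := KL_centered_L2 lam e Z_iid N x0.
have maff : measurable_fun [set: measurableTypeR R] (affine (mu x0) sigma : _ -> R).
  exact: measurable_affine.
pose m1 := measure_function_pushforward__canonical__measure_function_Measure
  (mrestr P mA) mX.
pose m0 := measure_function_pushforward__canonical__measure_function_Measure N01 maff.
have PA : (fine (P A))%:E = P A by rewrite fineK// fin_num_measure.
pose m2 := mscale (NngNum (fine_ge0 (measure_ge0 P A))) m0.
have m2E S : m2 S = (P A * N01 (affine (mu x0) sigma @^-1` S))%E.
  by rewrite /m2 /mscale/= PA.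
rewrite -m2E setIC -[LHS]/(m1 B).
apply: lipschitz_measure_unique => //.
- rewrite /= /pushforward preimage_setT /mrestr setTI.
  by rewrite (le_lt_trans (probability_le1 _ _))// ltry.
- rewrite [X in (X < _)%E]m2E preimage_setT probability_setT mule1.
  by rewrite (le_lt_trans (probability_le1 _ _))// ltry.
move=> g gt; have [g01 _] := gt.
have mg : measurable_fun setT (EFin \o g).
  by apply/measurable_EFinP; exact: lipschitz_test_measurable.
have g0 x : (0 <= (g x)%:E)%E by rewrite lee_fin; have /andP[] := g01 x.
have g0E : {in [set: R], forall y, 0 <= (EFin \o g) y}%E.
  by move=> y _; exact: g0.
have e1 : \int[m1]_x g x = \int[P]_(w in A) g (KL_sum mu lam Z e N x0 w).
  apply: (congr1 fine).
  have := @ge0_integral_pushforward _ _ _ _ R _ mX (mrestr P mA) setT _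
    measurableT mg g0E.
  rewrite preimage_setT => h; rewrite [LHS]h.
  apply: ge0_integral_mrestr; first exact: measurableT_comp mg mX.
  by move=> w; exact: g0.
have e2 : \int[m2]_x g x =
    fine (P A) * \int[N01]_z g (affine (mu x0) sigma z).
  have := @ge0_integral_mscale _ _ R m0 setT measurableT
    (NngNum (fine_ge0 (measure_ge0 P A))) (EFin \o g) mg (fun x _ => g0 x).
  have := @ge0_integral_pushforward _ _ _ _ R _ maff N01 setT _
    measurableT mg g0E.
  rewrite preimage_setT => -> /(congr1 fine) h; rewrite [LHS]h.
  rewrite fineM//.
  apply: integrable_fin_num => //.
  apply: (@bounded_integrable_probability _ _ _ N01 setT
    (fun z => g (affine (mu x0) sigma z)) 1) => //.
    exact: measurableT_comp (lipschitz_test_measurable gt) (measurable_affine _ _).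
  by move=> z _; have /andP[h0 h1] := g01 (affine (mu x0) sigma z); rewrite ger0_norm.
by rewrite e1 e2 KL_sum_lipschitz_law.
Qed.

End law_of_expansion.

(** * Evaluating a process at an independent random time *)

Section mixing.
Context disp (T : measurableType disp) (R : realType) (P : probability T R).

(** The absolute value only casts the floor to a natural number: for t >= 0 and eps > 0 the floor is
    nonnegative. *)
Definition grid_index (eps t : R) : nat := `|Num.floor (t / eps)|%N.

Lemma grid_index_eq eps t k : 0 < eps -> 0 <= t ->
  (grid_index eps t == k) = (k%:R * eps <= t < k.+1%:R * eps).
Proof.
move=> eps0 t0; have q0 : 0 <= t / eps by rewrite divr_ge0// ltW.
have f0 : 0 <= Num.floor (t / eps) by rewrite floor_ge0.
rewrite /grid_index -ler_pdivlMr// -ltr_pdivrMr//.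
have -> : (`|Num.floor (t / eps)|%N == k) = (Num.floor (t / eps) == k%:Z).
  by rewrite -eqz_nat gez0_abs.
by rewrite floor_eq intrD -natr1.
Qed.

Lemma grid_index_itv eps t : 0 < eps -> 0 <= t ->
  (grid_index eps t)%:R * eps <= t < (grid_index eps t).+1%:R * eps.
Proof. by move=> eps0 t0; rewrite -grid_index_eq. Qed.

Lemma grid_index_lt eps t m : 0 < eps -> 0 <= t -> t < m%:R * eps ->
  (grid_index eps t < m)%N.
Proof.
move=> eps0 t0 tm; have /andP[h _] := grid_index_itv eps0 t0.
by have := le_lt_trans h tm; rewrite ltr_pM2r// ltr_nat.
Qed.

Lemma preimage_grid_index eps (S : Type) (U : S -> R) k :
  0 < eps -> (forall w, 0 <= U w) ->
  [set w | grid_index eps (U w) = k] = U @^-1` `[k%:R * eps, k.+1%:R * eps[.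
Proof.
move=> eps0 U0; apply/seteqP; split=> w /=; rewrite in_itv/=.
  by move/eqP; rewrite grid_index_eq.
by rewrite -grid_index_eq// => /eqP.
Qed.

Lemma measurable_grid_index eps (c : nat -> R) d' (S : measurableType d') (U : S -> R) :
  0 < eps -> (forall w, 0 <= U w) -> measurable_fun setT U ->
  measurable_fun setT (fun w => c (grid_index eps (U w))).
Proof.
move=> eps0 U0 mU _ B mB; rewrite setTI.
rewrite (_ : _ @^-1` B =
  \bigcup_(k in [set k | B (c k)]) [set w | grid_index eps (U w) = k]).
  apply: bigcup_measurable => k _; rewrite preimage_grid_index//.
  by rewrite -[X in measurable X]setTI; apply: mU.
by apply/seteqP; split=> [w /= Bw|w [k /= Bk ->]//]; exists (grid_index eps (U w)).
Qed.

Lemma Rintegral_grid_index eps m (U : T -> R) (H : nat -> T -> R) : 0 < eps ->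
  (forall w, 0 <= U w < m%:R * eps) -> measurable_fun setT U ->
  (forall k, P.-integrable setT (EFin \o H k)) ->
  \int[P]_w H (grid_index eps (U w)) w =
  \sum_(k < m) \int[P]_(w in [set w | grid_index eps (U w) = k]) H k w.
Proof.
move=> eps0 Um mU iH.
have U0 w : 0 <= U w by have /andP[] := Um w.
have mA k : measurable [set w | grid_index eps (U w) = k].
  by rewrite preimage_grid_index// -[X in measurable X]setTI; apply: mU.
pose f (k : 'I_m) := (H k) \_ [set w | grid_index eps (U w) = k].
have if_ k : P.-integrable setT (EFin \o f k).
  rewrite /f -restrict_EFin; apply/(integrable_mkcond _ (mA k)).
  exact: integrableS (iH k).
have [_ fE] := Rintegral_sum (index_enum 'I_m) measurableT if_.
rewrite (@eq_Rintegral _ _ _ P setT (fun w => \sum_(k < m) f k w)); last first.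
  move=> w _; have /andP[_ Umw] := Um w.
  have km := grid_index_lt eps0 (U0 w) Umw.
  rewrite (bigD1 (Ordinal km))//= big1 ?addr0.
    by rewrite /f patchE mem_set.
  move=> k kU; rewrite /f patchE memNset// => /= kE.
  by move: kU; rewrite -val_eqE/= kE eqxx.
by rewrite fE; apply: eq_bigr => k _; rewrite -Rintegral_mkcond.
Qed.

(** On each of the m cells of U a single variable [X (tau k)] occurs, so independence of U from each
    of them separately suffices. *)
Lemma mixing_on_grid eps m (U : T -> R) (X : R -> T -> R) (tau : nat -> R)
    (phi : R -> R) (C : R) : 0 < eps ->
  (forall w, 0 <= U w < m%:R * eps) -> measurable_fun setT U ->
  (forall k, measurable_fun setT (X (tau k))) ->
  measurable_fun setT phi -> (forall x, `|phi x| <= C) ->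
  (forall k B B', measurable B -> measurable B' ->
    P (U @^-1` B' `&` X (tau k) @^-1` B) =
    (P (U @^-1` B') * P (X (tau k) @^-1` B))%E) ->
  \int[P]_w phi (X (tau (grid_index eps (U w))) w) =
  \int[P]_w (\int[P]_v phi (X (tau (grid_index eps (U w))) v)).
Proof.
move=> eps0 Um mU mX mphi phiC indep.
have U0 w : 0 <= U w by have /andP[] := Um w.
have mphiX k : measurable_fun setT (fun w => phi (X (tau k) w)).
  exact: measurableT_comp mphi (mX k).
rewrite (Rintegral_grid_index (m := m) (H := fun k w => phi (X (tau k) w)))//; last first.
  by move=> k; apply: (@bounded_integrable_probability _ _ _ P setT _ C).
rewrite (Rintegral_grid_index (m := m)
  (H := fun k w => \int[P]_v phi (X (tau k) v)))//; last first.
  move=> k; set r := Rintegral _ _ _.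
  exact: (@bounded_integrable_probability _ _ _ P setT (cst r) `|r|).
apply: eq_bigr => k _; rewrite preimage_grid_index//.
have mA : measurable (U @^-1` `[k%:R * eps, k.+1%:R * eps[).
  by rewrite -[X in measurable X]setTI; apply: mU.
rewrite Rintegral_cst// [RHS]mulrC.
apply: (indep_integral mA (mX k) mphi phiC) => B mB; exact: indep.
Qed.

Lemma cvg_at_right_seq (u : nat -> R) (t : R) : u @ \oo --> t ->
  (\forall k \near \oo, t < u k) -> u @ \oo --> t^'+.
Proof. by move=> ut tu A At; have := ut _ At; apply: filterS2 tu => k tk; exact. Qed.

(** For t < k+1, the first multiple of 1/(k+1) strictly above t: the right filter at t excludes t
    itself. Larger t are sent to the first cell, leaving finitely many grid times for each k; every
    t eventually falls below k+1. *)
Definition grid_above (k : nat) (t : R) : R :=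
  (grid_index k.+1%:R^-1 (if t < k.+1%:R then t else 0)).+1%:R / k.+1%:R.

Lemma grid_above_cvg t : 0 <= t -> grid_above ^~ t @ \oo --> t^'+.
Proof.
move=> t0.
have step k : t < k.+1%:R -> t < grid_above k t <= t + k.+1%:R^-1.
  move=> tk; rewrite /grid_above tk.
  have k0 : 0 < k.+1%:R^-1 :> R by rewrite invr_gt0.
  have /andP[h1 h2] := grid_index_itv k0 t0; rewrite h2/=.
  by rewrite -[in leLHS]natr1 mulrDl mul1r lerD2r.
have near_t : \forall k \near \oo, t < k.+1%:R.
  near=> k; rewrite (@lt_le_trans _ _ k%:R)// ?ler_nat//.
  near: k; exact: nbhs_infty_gtr.
apply: cvg_at_right_seq; last first.
  by apply: filterS near_t => k /step/andP[].
have h : t + k.+1%:R^-1 @[k --> \oo] --> t.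
  by rewrite -[X in _ --> X]addr0; apply: cvgD; [exact: cvg_cst|exact: cvg_harmonic].
apply: squeeze_cvgr (cvg_cst t) h.
by apply: filterS near_t => k /step/andP[/ltW -> ->].
Unshelve. all: by end_near. Qed.

(** The identity holds at the times [grid_above k (U w)] and passes to the limit by dominated
    convergence on both sides. Measurability of the process at the random time comes out of the same
    limit. *)
Lemma mixing_right_continuous (U : T -> R) (X : R -> {RV P >-> R})
    (phi : R -> R) (C : R) :
  (forall w, 0 <= U w) -> measurable_fun setT U ->
  (forall w t, 0 <= t -> X s w @[s --> t^'+] --> X t w) ->
  continuous phi -> (forall x, `|phi x| <= C) ->
  (forall t B B', 0 <= t -> measurable B -> measurable B' ->
    P (U @^-1` B' `&` X t @^-1` B) = (P (U @^-1` B') * P (X t @^-1` B))%E) ->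
  \int[P]_w phi (X (U w) w) = \int[P]_w (\int[P]_v phi (X (U w) v)).
Proof.
move=> U0 mU Xr cphi phiC indep.
have mphi : measurable_fun setT phi by exact: continuous_measurable_fun.
have mphiX t : measurable_fun setT (fun w => phi (X t w)).
  exact: measurableT_comp.
have iC : P.-integrable setT (EFin \o (fun _ : T => C)).
  exact: (@bounded_integrable_probability _ _ _ P setT (cst C) `|C|).
have iphiX t : P.-integrable setT (EFin \o (fun w => phi (X t w))).
  exact: (@bounded_integrable_probability _ _ _ P setT _ C).
pose trunc k t : R := if t < k.+1%:R then t else 0.
have mtrunc k : measurable_fun setT (trunc k).
  apply: measurable_fun_ifT => //; exact: measurable_fun_ltr.
pose Uk k w := trunc k (U w).
have Uk0 k w : 0 <= Uk k w by rewrite /Uk /trunc; case: ifP.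
have mUk k : measurable_fun setT (Uk k) by exact: measurableT_comp.
(* The truncated time lies below k+1, which takes (k+1)^2 cells of mesh 1/(k+1). *)
have Ukm k w : 0 <= Uk k w < (k.+1 * k.+1)%:R * k.+1%:R^-1.
  by rewrite Uk0 natrM mulfK//= /Uk /trunc; case: ifP.
pose tau k j : R := j.+1%:R / k.+1%:R.
have tau0 k j : 0 <= tau k j by rewrite divr_ge0.
have k0 k : 0 < k.+1%:R^-1 :> R by rewrite invr_gt0.
have tauE k w : tau k (grid_index k.+1%:R^-1 (Uk k w)) = grid_above k (U w) by [].
pose rho t := \int[P]_v phi (X t v).
have rhoC t : `|rho t| <= C.
  rewrite (le_trans (le_normr_Rintegral measurableT (iphiX t)))//.
  apply: (@le_trans _ _ (\int[P]_w C)).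
    apply: le_Rintegral => //; by have /integrable_norm := iphiX t.
  rewrite Rintegral_cst//.
  have -> : fine (P setT) = 1 by rewrite probability_setT.
  by rewrite mulr1.
have key k : \int[P]_w phi (X (grid_above k (U w)) w) =
    \int[P]_w rho (grid_above k (U w)).
  apply: (@mixing_on_grid k.+1%:R^-1 (k.+1 * k.+1)%N (Uk k) X (tau k) phi C) => //.
  move=> j B B' mB mB'; have := mtrunc k measurableT B' mB'; rewrite setTI => mB''.
  exact: (indep (tau k j) B (trunc k @^-1` B')).
have cvgX w : phi (X (grid_above k (U w)) w) @[k --> \oo] --> phi (X (U w) w).
  have h := cvg_comp _ _ (grid_above_cvg (U0 w)) (Xr w _ (U0 w)).
  exact: (cvg_comp _ _ h (cphi _)).
(* The mean function inherits right continuity from the paths, by dominated convergence at fixed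
   w. *)
have cvgrho w : rho (grid_above k (U w)) @[k --> \oo] --> rho (U w).
  have [] // := @Rintegral_dominated_cvg _ _ _ P setT
    (fun k v => phi (X (grid_above k (U w)) v)) (fun v => phi (X (U w) v))
    (fun=> C) measurableT _ _ iC _.
  move=> v _; have h := cvg_comp _ _ (grid_above_cvg (U0 w)) (Xr v _ (U0 w)).
  exact: (cvg_comp _ _ h (cphi _)).
have mlhs k : measurable_fun setT (fun w => phi (X (grid_above k (U w)) w)).
  move=> _ B mB; rewrite setTI.
  rewrite (_ : _ @^-1` B = \bigcup_j ([set w | grid_index k.+1%:R^-1 (Uk k w) = j] `&`
      (fun w => phi (X (tau k j) w)) @^-1` B)).
    apply: bigcup_measurable => j _; apply: measurableI.
      by rewrite preimage_grid_index// -[X in measurable X]setTI; apply: mUk.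
    by rewrite -[X in measurable X]setTI; apply: mphiX.
  apply/seteqP; split=> [w /= Bw|w [j _] /= [<-]//].
  by exists (grid_index k.+1%:R^-1 (Uk k w)).
have mrhs k : measurable_fun setT (fun w => rho (grid_above k (U w))).
  exact: (measurable_grid_index (fun j => rho (tau k j)) (k0 k) (Uk0 k) (mUk k)).
have [_ lim1] := Rintegral_dominated_cvg (mu := P) measurableT mlhs
  (fun w _ => cvgX w) iC (fun k w _ => phiC _).
have [_ lim2] := Rintegral_dominated_cvg (mu := P) measurableT mrhs
  (fun w _ => cvgrho w) iC (fun k w _ => rhoC _).
have lim1' : \int[P]_w rho (grid_above k (U w)) @[k --> \oo] -->
    \int[P]_w phi (X (U w) w).
  by apply: cvg_trans lim1; apply: near_eq_cvg; apply: nearW => k; rewrite key.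
by rewrite -(cvg_lim _ lim1')// (cvg_lim _ lim2).
Qed.

End mixing.

(** * Expectations as integrals against the normal density *)

Section normal_density.
Context disp (T : measurableType disp) (R : realType) (P : probability T R).

Lemma normal_density_ge0_integral m s (X : T -> R) (g : R -> R) : 0 < s ->
  normal_law P m s X -> measurable_fun setT X -> measurable_fun setT g ->
  (forall x, 0 <= g x) ->
  (\int[P]_w (g (X w))%:E = \int[lebesgue_measure]_y (g y * normal_pdf m s y)%:E)%E.
Proof.
move=> s0 lX mX mg g0.
rewrite -ge0_integral_normal_prob//.
have mid : measurable_fun [set: measurableTypeR R] (idfun : measurableTypeR R -> R).
  exact: measurable_id.
have mgE : measurable_fun setT (EFin \o g) by exact/measurable_EFinP.
have g0E : {in [set: R], forall y, 0 <= (EFin \o g) y}%E.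
  by move=> y _; rewrite lee_fin.
have e1 := @ge0_integral_pushforward _ _ _ _ R _ mX P setT _ measurableT mgE g0E.
have e2 := @ge0_integral_pushforward _ _ _ _ R _ mid (normal_prob m s) setT _
  measurableT mgE g0E.
rewrite !preimage_setT in e1 e2; apply: (etrans (esym e1) (etrans _ e2)).
apply: eq_measure_integral => B mB _; rewrite /= /pushforward.
rewrite [RHS](normal_probE m _ mB) ?gt_eqF// gtr0_norm//; exact: lX.
Qed.

Lemma normal_density_integral m s (X : T -> R) (g : R -> R) : 0 < s ->
  normal_law P m s X -> measurable_fun setT X -> measurable_fun setT g ->
  (forall x, `|g x| <= 1) ->
  \int[P]_w g (X w) = \int[lebesgue_measure]_y (g y * normal_pdf m s y) /\
  (@lebesgue_measure R).-integrable setT (EFin \o (fun y => g y * normal_pdf m s y)).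
Proof.
move=> s0 lX mX mg g1.
have ipdf := integrable_normal_pdf m s.
have mpdf : measurable_fun setT (normal_pdf m s) by exact: measurable_normal_pdf.
have ig : (@lebesgue_measure R).-integrable setT
    (EFin \o (fun y => g y * normal_pdf m s y)).
  apply: (le_integrable measurableT _ _ ipdf).
    by apply/measurable_EFinP; exact: measurable_funM.
  by move=> y _; rewrite /= lee_fin normrM ler_piMl.
split=> //.
have igX : P.-integrable setT (EFin \o (fun w => g (X w))).
  apply: (@bounded_integrable_probability _ _ _ P setT (fun w => g (X w)) 1) => //.
  exact: measurableT_comp.
have i1 : P.-integrable setT (EFin \o (fun _ : T => 1 : R)).
  apply: (@bounded_integrable_probability _ _ _ P setT (cst 1) 1) => // w _.
  by rewrite normr1.
(* Shift to the nonnegative case; the constant contributes 1 on both sides, as the density has total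
   mass 1. *)
have g10 x : 0 <= g x + 1 by have := g1 x; rewrite ler_norml; lra.
have := normal_density_ge0_integral s0 lX mX
  (measurable_funD mg (measurable_cst (1 : R))) g10.
move=> /(congr1 fine); rewrite -!/(Rintegral _ _ _) RintegralD//.
rewrite (Rintegral_cst P measurableT).
have -> : fine (P setT) = 1 by rewrite probability_setT.
under [X in _ = X -> _]eq_Rintegral do rewrite mulrDl mul1r.
rewrite RintegralD//.
rewrite [X in _ = _ + X](_ : _ = 1); last by rewrite /Rintegral integral_normal_pdf.
by rewrite mulr1 => /addIr.
Qed.

End normal_density.

(** * Characteristic functions split into cosine and sine parts *)

Section complex_exponential.
Context (R : realType).

Lemma cexp_imaginary (r : R) : cexp ('i%C * r%:C) = (cos r +i* sin r).
Proof.
rewrite /cexp /= !mul0r !mulr0 !mul1r subr0 ?add0r ?addr0 expR0.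
by rewrite /GRing.mul/= !mul1r !mul0r subr0 addr0.
Qed.

Lemma char_funE d (T : measurableType d) (P : probability T R) (X : T -> R) xi :
  char_fun P X xi =
  (\int[P]_w cos (xi * X w)) +i* (\int[P]_w sin (xi * X w)).
Proof.
rewrite /char_fun /Cexpectation /Cintegral.
by congr (_ +i* _); apply: eq_Rintegral => w _; rewrite cexp_imaginary.
Qed.

Lemma cexpB_real (z : R[i]) (r : R) :
  cexp (z - r%:C) = (expR (- r))%:C * cexp z.
Proof.
case: z => a b; rewrite /cexp /= subr0 expRD.
by apply/eqP; rewrite eq_complex /=; apply/andP; split; apply/eqP; ring.
Qed.

Lemma cos_norm_le1 (x : R) : `|cos x| <= 1.
Proof. by rewrite ler_norml cos_geN1 cos_le1. Qed.

Lemma sin_norm_le1 (x : R) : `|sin x| <= 1.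
Proof. by rewrite ler_norml sin_geN1 sin_le1. Qed.

End complex_exponential.

(** * Step processes on an equidistant grid *)

(** Up to Nl the grid is i eps, so exactly one indicator is nonzero at t: the one with i.-1 =
    [grid_index eps t]. *)
Lemma grid_sum_select (R : realType) (CF eps t : R) (Nl : nat) (grid c : nat -> R) :
  grid 0 = 0 -> grid Nl = CF -> 0 < eps ->
  (forall i, (i < Nl)%N -> grid i.+1 - grid i = eps) -> 0 <= t < CF ->
  [/\ t < Nl%:R * eps, (grid_index eps t < Nl)%N,
    grid (grid_index eps t) = (grid_index eps t)%:R * eps &
    \sum_(1 <= i < Nl.+1) \1_(`[grid i.-1, grid i[) t * c i.-1 =
    c (grid_index eps t)].
Proof.
move=> grid0 gridN eps0 step /andP[t0 tCF].
have gridE i : (i <= Nl)%N -> grid i = i%:R * eps.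
  elim: i => [|i ih] iN; first by rewrite mul0r.
  rewrite -[grid i.+1](subrK (grid i)) step// ih ?(ltnW iN)//.
  by rewrite -natr1 mulrDl mul1r addrC.
have tN : t < Nl%:R * eps by rewrite -gridE// gridN.
have kN := grid_index_lt eps0 t0 tN.
split=> //; first by rewrite gridE// ltnW.
rewrite big_add1/= big_mkord (bigD1 (Ordinal kN))//= big1 ?addr0.
  rewrite gridE ?(ltnW kN)// gridE// indicE mem_set ?mul1r//=.
  by rewrite in_itv/= grid_index_itv.
move=> i ik; rewrite indicE memNset ?mul0r//= in_itv/= !gridE ?(ltnW (ltn_ord i))//.
by move: ik; rewrite -val_eqE/= -grid_index_eq// eq_sym => /negbTE ->.
Qed.

(** * Characteristic function of the approximated field *)

Theorem corollary5p7 (R : realType) (disp : measure_display)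
    (T : measurableType disp) (P : probability T R)
    (Pcomplete : measure_is_complete P)
    (d : nat) (d_gt0 : (0 < d)%N) (D : R) (D_gt0 : 0 < D)
    (l : R -> {RV P >-> R}) (gamma b : R) (nu : {measure set R -> \bar R})
    (l_levy : levy_process l) (l_triplet : levy_triplet l gamma b nu)
    (W : d.-tuple R -> {RV P >-> R}) (muW : d.-tuple R -> R)
    (W_gauss : gaussian_field (cube D) W)
    (W_mean : forall x, cube D x -> 'E_P[W x]%E = (muW x)%:E)
    (lW_indep : independent_processes P
      [set t : R | 0 <= t] (fun t => l t : T -> R)
      (cube D) (fun x => W x : T -> R))
    (F : R -> R) (F_meas : measurable_fun setT F) (F_ge0 : forall y, 0 <= F y)
    (leps : R -> {RV P >-> R})
    (leps_cadlag : forall w, cadlag (fun t => leps t w))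
    (WN : d.-tuple R -> {RV P >-> R}) :
  (independent_processes P
      [set t : R | 0 <= t] (fun t => leps t : T -> R)
      (cube D) (fun x => WN x : T -> R) ->
    forall x, cube D x -> forall xi : R,
      char_fun P (fun w => leps (F (WN x w)) w) xi =
        Cexpectation P (fun w => cexp ('i%C * (xi * leps (F (WN x w)) w)%:C)) /\
      Cexpectation P (fun w => cexp ('i%C * (xi * leps (F (WN x w)) w)%:C)) =
        Cexpectation P (fun w => char_fun P (leps (F (WN x w))) xi))
  /\
  (forall (CF : R) (Nl : nat) (grid : nat -> R) (eps : R)
      (lam : nat -> R) (e : nat -> d.-tuple R -> R) (Z : nat -> {RV P >-> R})
      (N : nat),
    0 < CF -> (forall y, F y < CF) ->
    grid 0%N = 0 -> grid Nl = CF -> 0 < eps ->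
    (forall i, (i < Nl)%N -> grid i.+1 - grid i = eps) ->
    (forall t w, 0 <= t < CF ->
      leps t w = \sum_(1 <= i < Nl.+1)
        \1_(`[grid i.-1, grid i[) t * l (grid i.-1) w) ->
    cov_eigenpairs (cube D) W lam e ->
    iid_standard_normal Z ->
    KL_expansion (cube D) muW lam Z e W ->
    (forall x w, cube D x -> WN x w = KL_sum muW lam Z e N x w) ->
    forall x, cube D x ->
      let sigma2 := fine ('V_P[WN x]) in
      [/\ 'V_P[WN x] =
          'E_P[fun w => ((\sum_(i < N) Num.sqrt (lam i) * Z i w * e i x) ^+ 2)%R]%E,
          'V_P[WN x] = (\sum_(i < N) lam i * (e i x) ^+ 2)%:E &
          sigma2 != 0 -> forall xi : R,
            char_fun P (fun w => leps (F (WN x w)) w) xi =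
            ((Num.sqrt (2 * pi * sigma2))^-1)%:C *
            Cintegral (@lebesgue_measure R) setT (fun y =>
              cexp ((grid `|Num.floor (F y / eps)|%N)%:C
                      * char_exponent gamma b nu xi
                    - ((y - muW x) ^+ 2 / (2 * sigma2))%:C))]).
Proof.
have comp_indep (I : Type) (J : set I) (X : I -> T -> R) (x : d.-tuple R) t B B' :
    (forall A B, sigma_generated J X A ->
       sigma_generated (cube D) (fun x => WN x : T -> R) B ->
       P (A `&` B) = (P A * P B)%E) ->
    cube D x -> J t -> measurable B -> measurable B' ->
    P ((fun w => F (WN x w)) @^-1` B' `&` X t @^-1` B) =
    (P ((fun w => F (WN x w)) @^-1` B') * P (X t @^-1` B))%E.
  move=> indep Dx Jt mB mB'; rewrite setIC muleC.
  have mFB : measurable (F @^-1` B').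
    by have := F_meas measurableT _ mB'; rewrite setTI.
  apply: indep; apply: sub_sigma_algebra.
    by exists t => //; exists B => //; rewrite setTI.
  by exists x => //; exists (F @^-1` B') => //; rewrite setTI.
split.
- move=> indep x Dx xi; split=> //.
  pose U w := F (WN x w).
  have mU : measurable_fun setT U by exact: measurableT_comp.
  (* To be used with the cosine and the sine of xi y, complex integrals being defined through real
     and imaginary parts. *)
  have core (phi : R -> R) : continuous phi -> (forall y, `|phi y| <= 1) ->
      \int[P]_w phi (leps (U w) w) = \int[P]_w (\int[P]_v phi (leps (U w) v)).
    move=> cphi phi1; apply: (mixing_right_continuous (U := U) _ mU _ cphi phi1).
    + by move=> w; exact: F_ge0.
    + by move=> w t t0; have [] := leps_cadlag w t t0.
    + move=> t B B' t0 mB mB'.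
      exact: (comp_indep _ _ (fun t => leps t : T -> R) x t B B' indep).
  have cmul : continuous (fun y : R => xi * y).
    by move=> y; apply: cvgM; [exact: cvg_cst|exact: cvg_id].
  rewrite -[LHS]/(char_fun P (fun w => leps (F (WN x w)) w) xi) char_funE.
  rewrite /Cexpectation /Cintegral.
  congr (_ +i* _).
  + rewrite (core (fun y => cos (xi * y))).
    * by apply: eq_Rintegral => w _; rewrite char_funE.
    * by move=> y; apply: continuous_comp; [exact: cmul|exact: continuous_cos].
    * by move=> y; exact: cos_norm_le1.
  + rewrite (core (fun y => sin (xi * y))).
    * by apply: eq_Rintegral => w _; rewrite char_funE.
    * by move=> y; apply: continuous_comp; [exact: cmul|exact: continuous_sin].
    * by move=> y; exact: sin_norm_le1.
move=> CF Nl grid eps lam e Z N CF0 FCF grid0 gridN eps0 step lepsE.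
move=> eig Z_iid W_KL WNE x Dx.
have [e_basis lam_ge0 _ _] := eig.
set K := KL_centered lam e Z N x.
have lK : L2 P K by exact: KL_centered_L2.
have [mK _] := lK.
have WNEx : (WN x : T -> R) = fun w => muW x + K w.
  by apply/funext => w; rewrite WNE.
have meanE : fine 'E_P[WN x] = muW x.
  rewrite unlock -[LHS]/(\int[P]_w WN x w) WNEx RintegralD//; last 2 first.
  + exact: L2_integrable (L2_cst P (muW x)).
  + exact: L2_integrable lK.
  rewrite Rintegral_cst// (KL_centered_mean lam e Z_iid N x).
  have -> : fine (P setT) = 1 by rewrite probability_setT.
  by rewrite mulr1 addr0.
have varE : 'V_P[WN x] =
    'E_P[fun w => ((\sum_(i < N) Num.sqrt (lam i) * Z i w * e i x) ^+ 2)%R]%E.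
  rewrite /variance [in LHS]unlock /= meanE; congr ('E_P[_])%E.
  apply/funext => w; rewrite /= /cst WNEx -expr2; congr (_ ^+ 2).
  by rewrite -[LHS]/(muW x + K w - muW x) addrC addKr.
have momE : 'E_P[fun w => ((\sum_(i < N) Num.sqrt (lam i) * Z i w * e i x) ^+ 2)%R]%E =
    (dot P K K)%:E.
  rewrite unlock /dot /Rintegral fineK; last first.
    by apply: integrable_fin_num => //; exact: L2_mul.
  by apply: eq_integral => w _; rewrite expr2.
have KKE : dot P K K = \sum_(i < N) lam i * e i x ^+ 2.
  exact: KL_centered_second_moment.
move=> sigma2; split=> //; first by rewrite varE momE KKE.
move=> sigma2_neq0 xi.
have s2E : sigma2 = dot P K K by rewrite /sigma2 varE momE.
pose s := nrm P K.
have ss : s ^+ 2 = sigma2 by rewrite nrm_sqr s2E.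
have s0 : 0 < s.
  rewrite lt_neqAle nrm_ge0 andbT eq_sym; apply: contra sigma2_neq0 => /eqP s0.
  by rewrite -ss s0 expr0n.
(* Used twice: with A the whole space for [lawWN], and with A an event of [l] for [indep]. *)
have joint A B : measurable A ->
    (forall B, sigma_generated (cube D) (fun x => W x : T -> R) B ->
      P (A `&` B) = (P A * P B)%E) -> measurable B ->
    P (A `&` WN x @^-1` B) =
    (P A * @normal_prob R 0 1 (affine (muW x) s @^-1` B))%E.
  move=> mA indepA mB.
  rewrite -(KL_sum_law Z_iid lam_ge0 W_mean W_KL W_gauss e_basis mA indepA N Dx mB).
  by congr (P (A `&` _)); apply/funext => w; rewrite /preimage/= WNE.
have lawWN : normal_law P (muW x) s (WN x).
  move=> B mB; have := joint setT B measurableT _ mB.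
  rewrite setTI probability_setT mul1e; apply => S _.
  by rewrite setTI mul1e.
pose psi := char_exponent gamma b nu xi.
pose U w := F (WN x w).
have mU : measurable_fun setT U by exact: measurableT_comp.
have U0 w : 0 <= U w by exact: F_ge0.
have UCF w : 0 <= U w < CF by rewrite U0 FCF.
have lepsU w : leps (U w) w = l ((grid_index eps (U w))%:R * eps) w.
  have [_ _ gE] := grid_sum_select (fun k => l (grid k) w) grid0 gridN eps0 step (UCF w).
  by rewrite lepsE// => ->; rewrite gE.
have Um w : 0 <= U w < Nl%:R * eps.
  have [UN _ _ _] :=
    grid_sum_select (fun k => l (grid k) w) grid0 gridN eps0 step (UCF w).
  by rewrite U0.
have indep k B B' : measurable B -> measurable B' ->
    P (U @^-1` B' `&` l (k%:R * eps) @^-1` B) =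
    (P (U @^-1` B') * P (l (k%:R * eps)%R @^-1` B))%E.
  move=> mB mB'; have ke0 : 0 <= k%:R * eps by rewrite mulr_ge0// ltW.
  have mFB : measurable (F @^-1` B').
    by have := F_meas measurableT _ mB'; rewrite setTI.
  (* Writing the probability of the event of [U] as a normal mass turns the product rule into
     [joint]. *)
  rewrite setIC muleC [X in (_ * X)%E](lawWN _ mFB); apply: joint => //.
    by rewrite -[X in measurable X]setTI; exact: measurable_funP.
  move=> S WS; apply: lW_indep => //.
  exact: (sigma_generated_preimage (X := fun t => l t : T -> R)).
have step_density (phi g : R -> R) : continuous phi -> (forall y, `|phi y| <= 1) ->
    measurable_fun setT g ->
    (forall w, \int[P]_v phi (l ((grid_index eps (U w))%:R * eps) v) = g (WN x w)) ->
    (forall y, `|g y| <= 1) ->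
    \int[P]_w phi (leps (U w) w) =
    (Num.sqrt (2 * pi * sigma2))^-1 * \int[lebesgue_measure]_y
      (expR (- ((y - muW x) ^+ 2 / (2 * sigma2))) * g y).
  move=> cphi phi1 mg phig g1.
  under eq_Rintegral do rewrite lepsU.
  rewrite (mixing_on_grid (X := fun t => l t : T -> R) (tau := fun k => k%:R * eps)
    eps0 Um mU _ _ phi1)//; last exact: continuous_measurable_fun.
  under eq_Rintegral do rewrite phig.
  have [-> ig] := normal_density_integral s0 lawWN (measurable_funPT (WN x)) mg g1.
  set c := (Num.sqrt _)^-1.
  have c0 : c != 0.
    rewrite invr_eq0 sqrtr_eq0 -ltNge !mulr_gt0 ?pi_gt0// -ss exprn_gt0//.
  have pdfE y : normal_pdf (muW x) s y =
      c * expR (- ((y - muW x) ^+ 2 / (2 * sigma2))).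
    rewrite normal_pdfE ?gt_eqF// /normal_peak /normal_fun ss /c mulNr.
    have -> : sigma2 * pi *+ 2 = 2 * pi * sigma2.
      by rewrite -[LHS]mulr_natl (mulrC sigma2) mulrA.
    by rewrite -[sigma2 *+ 2]mulr_natl.
  (* The normalizing constant c is nonzero, so the unnormalized integrand is 1/c times the one with
     the density, whose integrability is known. *)
  rewrite [in RHS](_ : \int[_]_y _ =
      \int[lebesgue_measure]_y (c^-1 * (g y * normal_pdf (muW x) s y))).
    by rewrite RintegralZl// mulrA divff// mul1r.
  by apply: eq_Rintegral => y _; rewrite pdfE (mulrCA (g y)) mulKf// mulrC.
have cmul : continuous (fun y : R => xi * y).
  by move=> y; apply: cvgM; [exact: cvg_cst|exact: cvg_id].
have [_ _ l_char] := l_triplet.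
have charU y : char_fun P (l (grid (grid_index eps (F y)))) xi =
    cexp ((grid (grid_index eps (F y)))%:C * psi).
  apply: l_char.
  have Fy : 0 <= F y < CF by rewrite F_ge0 FCF.
  have [_ _ -> _] := grid_sum_select (fun k => 0) grid0 gridN eps0 step Fy.
  by rewrite mulr_ge0// ltW.
have gridU w : (grid_index eps (U w))%:R * eps = grid (grid_index eps (U w)).
  by have [_ _ -> _] := grid_sum_select (fun k => 0) grid0 gridN eps0 step (UCF w).
(* The integrand depends on y only through a grid index, hence is measurable whatever [part] is. *)
have mpart (part : R[i] -> R) : measurable_fun setT
    (fun y => part (cexp ((grid (grid_index eps (F y)))%:C * psi))).
  exact: (measurable_grid_index (fun k => part (cexp ((grid k)%:C * psi))) eps0 F_ge0).
(* The parts of exp(t psi) are bounded by 1 because they are expectations of a cosine or sine of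
   [l]; the sign of Re psi need not be studied. *)
have part_le1 (phi : R -> R) (X : {RV P >-> R}) : continuous phi ->
    (forall y, `|phi y| <= 1) -> `|\int[P]_v phi (X v)| <= 1.
  move=> cphi phi1.
  have iphi : P.-integrable setT (EFin \o (fun v => phi (X v))).
    apply: (@bounded_integrable_probability _ _ _ P setT (fun v => phi (X v)) 1) => //.
    by apply: measurableT_comp => //; exact: continuous_measurable_fun.
  rewrite (le_trans (le_normr_Rintegral measurableT iphi))//.
  apply: (@le_trans _ _ (\int[P]_v 1)).
    apply: le_Rintegral => //; first by have /integrable_norm := iphi.
    apply: (@bounded_integrable_probability _ _ _ P setT (cst 1) 1) => // v _.
    by rewrite normr1.
  rewrite Rintegral_cst//.
  have -> : fine (P setT) = 1 by rewrite probability_setT.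
  by rewrite mulr1.
have ccos : continuous (fun y => cos (xi * y)).
  by move=> y; apply: continuous_comp; [exact: cmul|exact: continuous_cos].
have csin : continuous (fun y => sin (xi * y)).
  by move=> y; apply: continuous_comp; [exact: cmul|exact: continuous_sin].
rewrite char_funE /Cintegral.
rewrite (step_density (fun y => cos (xi * y))
  (fun y => complex.Re (cexp ((grid (grid_index eps (F y)))%:C * psi)))) //; last 3 first.
- by move=> y; exact: cos_norm_le1.
- by move=> w; rewrite gridU -charU char_funE.
- move=> y; rewrite -charU char_funE /=.
  by apply: (part_le1 (fun y => cos (xi * y))) => // z; exact: cos_norm_le1.
rewrite (step_density (fun y => sin (xi * y))
  (fun y => complex.Im (cexp ((grid (grid_index eps (F y)))%:C * psi)))) //; last 3 first.
- by move=> y; exact: sin_norm_le1.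
- by move=> w; rewrite gridU -charU char_funE.
- move=> y; rewrite -charU char_funE /=.
  by apply: (part_le1 (fun y => sin (xi * y))) => // z; exact: sin_norm_le1.
have mulRC (a u v : R) : a%:C * (u +i* v) = (a * u) +i* (a * v).
  by apply/eqP; rewrite eq_complex /=; apply/andP; split; apply/eqP; ring.
have reE (a : R) (z : R[i]) : complex.Re (a%:C * z) = a * complex.Re z.
  by case: z => u v /=; ring.
have imE (a : R) (z : R[i]) : complex.Im (a%:C * z) = a * complex.Im z.
  by case: z => u v /=; ring.
rewrite mulRC; congr (_ +i* _); congr (_ * _); apply: eq_Rintegral => y _.
- by rewrite cexpB_real [RHS]reE.
- by rewrite cexpB_real [RHS]imE.
Qed.
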